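(* Let $m\ge2$, $1\le n\le m$, let $\rho_{AB_1\cdots B_n}$ be a state, and let $\mathbf{X}=\{X_1,\dots,X_m\}$ be POVMs on $A$, partitioned into nonempty pairwise disjoint subsets $\mathbf{S}_1,\dots,\mathbf{S}_n$ with $m_t=|\mathbf{S}_t|$. Then $$\sum_{t=1}^n\sum_{X_i\in\mathbf{S}_t}S(X_i|B_t)\ \ge\ \frac{1}{m-1}\sum_{t=1}^n\frac{m_t(m_t-1)}{2}S(A|B_t)+\frac{1}{m-1}\sum_{i<j}q^{X_{i,j}}(\rho_A)-\frac{1}{m-1}\sum_{t=1}^n\sum_{\substack{X_{i'},X_{j'}\in\mathbf{S}_t\\ i'<j'}}f_t^{X_{i',j'}}+\max\{0,\kappa_{mn}\},$$ where $$\kappa_{mn}=\frac{m(m-1)-\sum_t m_t(m_t-1)}{2(m-1)}S(A)+\sum_{t=1}^n\frac{m_t(m_t-1)}{2(m-1)}\mathcal{I}(A:B_t)-\sum_{t=1}^n\sum_{X_i\in\mathbf{S}_t}\mathcal{I}(X_i:B_t)+\frac{1}{m-1}\Big[\sum_{t=1}^n\sum_{\substack{X_{i'},X_{j'}\in\mathbf{S}_t\\ i'<j'}}f_t^{X_{i',j'}}-\sum_{i<j}\tilde f^{X_{i,j}}\Big].$$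
   Context: All logarithms are base 2; all spaces finite-dimensional. $S(\sigma)=-\mathrm{tr}\,\sigma\log_2\sigma$; $S(A)=S(\rho_A)$, $S(A|B_t)=S(\rho_{AB_t})-S(\rho_{B_t})$, $\mathcal{I}(A:B_t)=S(\rho_A)+S(\rho_{B_t})-S(\rho_{AB_t})$. A POVM $X=\{X_k\}$ on $A$ is a family of positive semidefinite operators with $\sum_kX_k=I_A$. For a POVM $X_i=\{X^i_k\}$: $p^{X_i}_k=\mathrm{tr}(X^i_k\rho_A)$, $H(X_i)=-\sum_kp^{X_i}_k\log_2p^{X_i}_k$; for a subsystem $Y$, $\rho_{X_iY}=\sum_k|k\rangle\langle k|\otimes\mathrm{tr}_A[(X^i_k\otimes I_Y)\rho_{AY}]$ (classical register with orthonormal basis $\{|k\rangle\}$), $S(X_i|Y)=S(\rho_{X_iY})-S(\rho_Y)$, $\mathcal{I}(X_i:Y)=H(X_i)+S(\rho_Y)-S(\rho_{X_iY})$. The post-measurement states $\rho_{X_iAY}=\sum_k|k\rangle\langle k|\otimes(\sqrt{X^i_k}\otimes I_Y)\rho_{AY}(\sqrt{X^i_k}\otimes I_Y)$ and $\rho_{X_iA}=\sum_k|k\rangle\langle k|\otimes\sqrt{X^i_k}\rho_A\sqrt{X^i_k}$ define $S(A|YX_i)=S(\rho_{X_iAY})-S(\rho_{X_iY})$ and $S(A|X_i)=S(\rho_{X_iA})-S(\rho_{X_i})$. Set $f_t^{X_{i,j}}=\min\{S(A|B_tX_i),S(A|B_tX_j)\}$ and $\tilde f^{X_{i,j}}=\min\{S(A|X_i),S(A|X_j)\}$.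 With $h_k(X_i,X_j)=\|\sum_lX^j_lX^i_kX^j_l\|_\infty$ (operator norm) and $h_l(X_j,X_i)=\|\sum_kX^i_kX^j_lX^i_k\|_\infty$, define $q^{X_{i,j}}(\rho_A)=\max\{-\sum_kp^{X_i}_k\log_2h_k(X_i,X_j),\ -\sum_lp^{X_j}_l\log_2h_l(X_j,X_i)\}$. *)

(* Defs.v *)
From HB Require Import structures.
From mathcomp Require Import all_boot all_order all_algebra.
From mathcomp Require Import boolp classical_sets reals exp.
From mathcomp Require Import complex.
Set Implicit Arguments. Unset Strict Implicit. Unset Printing Implicit Defensive.
Import Order.TTheory GRing.Theory Num.Theory.
Local Open Scope ring_scope.

Section QI.
Variable R : realType.
Local Notation C := R[i].

Definition log2 (x : R) : R := ln x / ln 2.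
Definition xlog2x (x : R) : R := if x == 0 then 0 else x * log2 x.

(** operators on the finite-dimensional Hilbert space C^T, T a finite index type
    (an orthonormal basis); f a a' is the matrix entry <a|f|a'> *)
Definition Op (T : finType) := T -> T -> C.

Definition mxOf (T : finType) (f : Op T) : 'M[C]_#|T| :=
  \matrix_(i, j) f (enum_val i) (enum_val j).
Definition opOf (T : finType) (M : 'M[C]_#|T|) : Op T :=
  fun a b => M (enum_rank a) (enum_rank b).

Definition opmul (T : finType) (f g : Op T) : Op T :=
  fun a a' => \sum_(b : T) f a b * g b a'.
Definition opid (T : finType) : Op T := fun a a' => (a == a')%:R.

Definition adjmx m n (M : 'M[C]_(m, n)) : 'M[C]_(n, m) := (map_mx Num.conj M)^T.
Definition psdmx d (M : 'M[C]_d) : Prop :=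
  adjmx M = M /\ forall v : 'cV[C]_d, 0 <= (adjmx v *m M *m v) 0 0.
Definition psd (T : finType) (f : Op T) : Prop := psdmx (mxOf f).

(** eigenvalues with multiplicity: a sequence of roots of the characteristic
    polynomial (which splits over the algebraically closed field R[i]) *)
Definition spec d (M : 'M[C]_d) : seq C :=
  xget [::] [set rs : seq C | char_poly M = \prod_(z <- rs) ('X - z%:P)].

Definition ventropy d (M : 'M[C]_d) : R := - \sum_(z <- spec M) xlog2x (complex.Re z).
Definition Sop (T : finType) (f : Op T) : R := ventropy (mxOf f).

Definition opnorm d (M : 'M[C]_d) : R :=
  Num.sqrt (\big[Num.max/0]_(z <- spec (adjmx M *m M)) complex.Re z).

Definition sqrtm d (M : 'M[C]_d) : 'M[C]_d := xget 0 [set Y | psdmx Y /\ Y *m Y = M].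
Definition sqrtOp (T : finType) (f : Op T) : Op T := opOf (sqrtm (mxOf f)).

Definition density (T : finType) (f : Op T) : Prop := psd f /\ \sum_(x : T) f x x = 1.
Definition isPOVM (T O : finType) (X : O -> Op T) : Prop :=
  (forall k, psd (X k)) /\ (forall a a', \sum_(k : O) X k a a' = opid a a').

Definition ptrR (T U : finType) (f : Op (T * U)%type) : Op T :=
  fun a a' => \sum_(u : U) f (a, u) (a', u).
Definition ptrL (T U : finType) (f : Op (T * U)%type) : Op U :=
  fun u u' => \sum_(a : T) f (a, u) (a, u').

(** multipartite system A B_1 ... B_n: basis indices (a, b) with b : forall t, B t *)
Definition Jsys (A : finType) n (B : 'I_n -> finType) : finType :=
  (A * {dffun forall t : 'I_n, B t})%type.

Definition redAB (A : finType) n (B : 'I_n -> finType) (rho : Op (Jsys A B)) (t : 'I_n)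
  : Op (A * B t)%type :=
  fun p p' => \sum_(b : {dffun forall s : 'I_n, B s}) \sum_(b' : {dffun forall s : 'I_n, B s})
     if [&& b t == p.2, b' t == p'.2 & [forall s, (s != t) ==> (b s == b' s)]]
     then rho (p.1, b) (p'.1, b') else 0.
Definition redA (A : finType) n (B : 'I_n -> finType) (rho : Op (Jsys A B)) : Op A :=
  ptrR rho.

Section Meas.
Variables (A O : finType) (X : O -> Op A).

Definition prob (rhoA : Op A) (k : O) : R :=
  complex.Re (\sum_(a : A) \sum_(a' : A) X k a a' * rhoA a' a).
Definition shannon (rhoA : Op A) : R := - \sum_(k : O) xlog2x (prob rhoA k).

(** rho_{XY} = sum_k |k><k| (x) tr_A[(X_k (x) I) rho_{AY}] *)
Definition cqXY (Y : finType) (rhoAY : Op (A * Y)%type) : Op (O * Y)%type :=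
  fun p p' => if p.1 == p'.1 then
    \sum_(a : A) \sum_(a'' : A) X p.1 a a'' * rhoAY (a'', p.2) (a, p'.2) else 0.

(** rho_{XAY} = sum_k |k><k| (x) (sqrt X_k (x) I) rho_{AY} (sqrt X_k (x) I) *)
Definition postXAY (Y : finType) (rhoAY : Op (A * Y)%type) : Op (O * (A * Y))%type :=
  fun p p' => if p.1 == p'.1 then
    \sum_(a1 : A) \sum_(a2 : A)
      sqrtOp (X p.1) p.2.1 a1 * rhoAY (a1, p.2.2) (a2, p'.2.2) * sqrtOp (X p.1) a2 p'.2.1
    else 0.

(** rho_{XA} = sum_k |k><k| (x) sqrt X_k rho_A sqrt X_k *)
Definition postXA (rhoA : Op A) : Op (O * A)%type :=
  fun p p' => if p.1 == p'.1 then
    \sum_(a1 : A) \sum_(a2 : A) sqrtOp (X p.1) p.2 a1 * rhoA a1 a2 * sqrtOp (X p.1) a2 p'.2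
    else 0.
Definition rhoX (rhoA : Op A) : Op O := ptrR (postXA rhoA).

Definition condS_XY (Y : finType) (rhoA : Op A) (rhoAY : Op (A * Y)%type) : R :=
  Sop (cqXY rhoAY) - Sop (ptrL rhoAY).
Definition mutual_XY (Y : finType) (rhoA : Op A) (rhoAY : Op (A * Y)%type) : R :=
  shannon rhoA + Sop (ptrL rhoAY) - Sop (cqXY rhoAY).
Definition condS_A_YX (Y : finType) (rhoAY : Op (A * Y)%type) : R :=
  Sop (postXAY rhoAY) - Sop (cqXY rhoAY).
Definition condS_A_X (rhoA : Op A) : R :=
  Sop (postXA rhoA) - Sop (rhoX rhoA).
End Meas.

Definition condS_AY (A Y : finType) (rhoAY : Op (A * Y)%type) : R :=
  Sop rhoAY - Sop (ptrL rhoAY).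
Definition mutual_AY (A Y : finType) (rhoAY : Op (A * Y)%type) : R :=
  Sop (ptrR rhoAY) + Sop (ptrL rhoAY) - Sop rhoAY.

Definition hk (A Oi Oj : finType) (Xi : Oi -> Op A) (Xj : Oj -> Op A) (k : Oi) : R :=
  opnorm (mxOf (fun a a' => \sum_(l : Oj) opmul (opmul (Xj l) (Xi k)) (Xj l) a a')).

Definition qXX (A Oi Oj : finType) (Xi : Oi -> Op A) (Xj : Oj -> Op A) (rhoA : Op A) : R :=
  Num.max (- \sum_(k : Oi) prob Xi rhoA k * log2 (hk Xi Xj k))
          (- \sum_(l : Oj) prob Xj rhoA l * log2 (hk Xj Xi l)).

End QI.
Arguments redAB {R A n B} rho t _ _.

(* Main.v *)
(** The idea: for a pair of operators [(rho, sigma)] and [0 < u < 1] let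
    [Q_u = sup_Y (2 Re tr (rho Y) - u tr (sigma Y Y^dag) - (1-u) tr (rho Y^dag Y))].
    In eigenbases, with eigenvalues [p_i], [q_j] and overlaps [c_ij], one has
    [Q_u = sum p_i c_ij * p_i / (u q_j + (1-u) p_i)], while
    [F u = sum p_i c_ij ln (u q_j + (1-u) p_i)] satisfies [F' = (tr rho - Q_u) / u]
    and [F 0 - F 1] is the relative entropy.  So an inequality between the [Q_u] of
    two pairs integrates to one between relative entropies.
    For a pure state on ABCD, [S(Z|C)] is the relative entropy of the isometrically
    measured state [sum_l |l> sqrt Z_l rho_ABD sqrt Z_l' <l'|] to its pinching.  Testing
    its [Q_u] with [Phi = sum_k X_k (x) Y_k (x) 1] and using the Kadison-Schwarz
    inequality [Phi^dag Phi <= sum_k X_k (x) Y_k^dag Y_k] together with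
    [sum_l Z_l X_k Z_l <= h_k] bounds it below by the relative entropy of [rho_XB] to
    [sum_k h_k |k><k| (x) rho_B].  This is [S(X|B) + S(Z|C) >= - sum_k p_k log h_k].
    With [B], [C] two distinct memories it treats two POVMs in different classes; with
    [C] purifying [AB] it treats two POVMs in one class, since then
    [S(Z|C) = S(rho_ZAB) - S(rho_AB)]; with [B] trivial it gives the bounds on
    [H(X_i) + H(X_j)].  The theorem sums these over all pairs [i < j]. *)
Require Import Defs.
From HB Require Import structures.
From mathcomp Require Import all_boot all_order all_algebra.
From mathcomp Require Import reals exp.
From mathcomp Require Import complex.
From mathcomp Require classical_sets topology normedtype derive realfun.
From mathcomp Require Import boolp sesquilinear spectral ring lra.
Import Order.TTheory GRing.Theory Num.Theory.
Local Open Scope ring_scope.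

(** * Relative entropy from resolvents *)

Section RelativeEntropy.
Set Implicit Arguments. Unset Strict Implicit. Unset Printing Implicit Defensive.
Import topology normedtype derive realfun numFieldNormedType.Exports.

Lemma is_derive_wln (R : realType) (w a b u : R) : 0 < a * u + b ->
  is_derive u 1 (fun x => w * ln (a * x + b)) (w * (a / (a * u + b))).
Proof.
move=> h.
have h1 : is_derive (a * u + b) 1 (@ln R) (a * u + b)^-1 by exact: is_derive1_ln.
have h2 : is_derive u 1 (fun x => a * x + b) a.
  by apply: is_derive_eq; rewrite ?scaler0 ?addr0 ?add0r /GRing.scale /= mulr1.
have h3 := @is_derive1_comp R (@ln R) (fun x : R => a * x + b) u _ _ h1 h2.
by apply: is_derive_eq; rewrite /GRing.scale /= [_^-1 * a]mulrC.
Qed.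

(** Put [G u = sum_i w_i ln (u q_i + (1 - u) p_i)]. Because the weights sum to 0, [G'] at [u > 0] is
    minus the sum assumed nonnegative, divided by [u]. Hence [G 1 <= G 0], which is the claim. The
    weights may have either sign. *)
Lemma resolvent_ln (R : realType) (I : finType) (w p q : I -> R) :
  (forall i, 0 < p i) -> (forall i, 0 < q i) -> \sum_i w i = 0 ->
  (forall u : R, 0 < u < 1 -> 0 <= \sum_i w i * (p i / (u * q i + (1 - u) * p i))) ->
  0 <= \sum_i w i * (ln (p i) - ln (q i)).
Proof.
move=> p0 q0 w0 H.
pose G (u : R) := \sum_i w i * ln ((q i - p i) * u + p i).
pose dG (u : R) := \sum_i w i * ((q i - p i) / ((q i - p i) * u + p i)).
have pos (u : R) i : 0 <= u <= 1 -> 0 < (q i - p i) * u + p i.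
  move=> /andP[u0 u1]; have := p0 i; have := q0 i; nra.
have dr (u : R) : 0 <= u <= 1 -> is_derive u 1 G (dG u).
  move=> hu; rewrite /G /dG; elim: (index_enum I) => [|i r IH].
    rewrite big_nil (_ : (fun _ => _) = (fun=> 0 : R)); first exact: is_derive_cst.
    by apply/funext => x; rewrite big_nil.
  rewrite big_cons; have := is_deriveD (is_derive_wln (w i) (pos u i hu)) IH.
  by congr is_derive; apply/funext => x; rewrite big_cons.
(* The mean value theorem asks for the sign of [G'] only at an interior point, where division by [u]
   is harmless. *)
have [||c] := @MVT R G dG 0 1 ltr01.
- by move=> x; rewrite in_itv /= => /andP[/ltW ? /ltW ?]; apply: dr; apply/andP.
- apply: derivable_within_continuous => x; rewrite in_itv /= => hx.
  by have [] := dr _ hx.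
rewrite in_itv /= => hc; have /andP[c0 c1] := hc.
rewrite subr0 mulr1 => e.
have : dG c <= 0.
  suff -> : dG c = - (\sum_i w i * (p i / (c * q i + (1 - c) * p i))) / c.
    by rewrite mulNr oppr_le0 divr_ge0 ?H // ltW.
  apply: (mulIf (lt0r_neq0 c0)); rewrite divfK ?gt_eqF //.
  transitivity (\sum_i w i - \sum_i w i * (p i / (c * q i + (1 - c) * p i))).
    rewrite /dG mulr_suml -sumrB; apply: eq_bigr => i _.
    have -> : c * q i + (1 - c) * p i = (q i - p i) * c + p i by ring.
    field; apply/lt0r_neq0/pos; lra.
  by rewrite w0 sub0r.
rewrite -e /G => h.
rewrite (_ : \sum_i _ = - (G 1 - G 0)) ?oppr_ge0 //.
rewrite /G -sumrB -sumrN; apply: eq_bigr => i _.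
by rewrite mulr1 mulr0 add0r subrK; ring.
Qed.

(** Both sides are merged into one signed family on [I + J], with weights [w] and [- w'], to which
    [resolvent_ln] applies. *)
Lemma resolvent_relent (R : realType) (I J : finType) (w p q : I -> R)
    (w' p' q' : J -> R) :
  (forall i, w i != 0 -> 0 < p i /\ 0 < q i) ->
  (forall j, w' j != 0 -> 0 < p' j /\ 0 < q' j) ->
  \sum_i w i = \sum_j w' j ->
  (forall u : R, 0 < u < 1 ->
     \sum_j w' j * (p' j / (u * q' j + (1 - u) * p' j)) <=
     \sum_i w i * (p i / (u * q i + (1 - u) * p i))) ->
  \sum_j w' j * (ln (p' j) - ln (q' j)) <= \sum_i w i * (ln (p i) - ln (q i)).
Proof.
move=> h h' ew H.
pose v (k : I + J) := match k with inl i => w i | inr j => - w' j end.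
(* Indices of weight zero contribute nothing; the value 1 there supplies the positivity that
   [resolvent_ln] demands at every index. *)
pose P (k : I + J) :=
  if v k == 0 then 1 else match k with inl i => p i | inr j => p' j end.
pose Q (k : I + J) :=
  if v k == 0 then 1 else match k with inl i => q i | inr j => q' j end.
(* Stated for any [F] because it serves twice: for the logarithms and for the resolvents. *)
have E (F : R -> R -> R) :
    \sum_i w i * F (p i) (q i) - \sum_j w' j * F (p' j) (q' j) =
    \sum_k v k * F (P k) (Q k).
  rewrite big_sumType /= -sumrN.
  congr (_ + _); apply: eq_bigr => k _; rewrite /P /Q /v /=; last rewrite oppr_eq0.
    by case: eqP => // ->; rewrite !mul0r.
  by case: eqP => [->|_]; rewrite ?oppr0 ?mul0r ?oppr0 ?mulNr.
rewrite -subr_ge0 (E (fun x y => ln x - ln y)); apply: resolvent_ln.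
- case=> k; rewrite /P /v /= ?oppr_eq0; case: (boolP (_ == 0)) => // hk.
    by case: (h _ hk).
  by case: (h' _ hk).
- case=> k; rewrite /Q /v /= ?oppr_eq0; case: (boolP (_ == 0)) => // hk.
    by case: (h _ hk).
  by case: (h' _ hk).
- by rewrite big_sumType /= sumrN ew subrr.
move=> u hu; rewrite -(E (fun x y => x / (u * y + (1 - u) * x))) subr_ge0; exact: H.
Qed.

End RelativeEntropy.

(** * Spectra and entropy of matrices *)

Section MatrixEntropy.
Set Implicit Arguments. Unset Strict Implicit. Unset Printing Implicit Defensive.
Local Open Scope complex_scope.
(** Two block triangular factors bring the same matrix [L] to block triangular form, one leaving
    [X - AB] and the other [X - BA] on the diagonal; the determinants are then compared. *)
Lemma char_poly_mulC (K : comNzRingType) m n (A : 'M[K]_(m, n)) (B : 'M[K]_(n, m)) :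
  'X^n * char_poly (A *m B) = 'X^m * char_poly (B *m A).
Proof.
pose a := map_mx polyC A; pose b := map_mx polyC B.
pose L := block_mx ('X%:M : 'M_m) a b (1%:M : 'M_n).
have e1 : \det L = char_poly (A *m B).
  have : \det (block_mx (1%:M : 'M_m) (- a) 0 (1%:M : 'M_n) *m L) = char_poly (A *m B).
    rewrite mulmx_block !mul1mx !mul0mx !add0r mulNmx mulmx1 subrr det_lblock det1 mulr1.
    by rewrite /char_poly /char_poly_mx map_mxM.
  by rewrite det_mulmx det_ublock !det1 !mul1r.
have : \det (block_mx (1%:M : 'M_m) 0 (- b) ('X%:M : 'M_n) *m L) = 'X^m * char_poly (B *m A).
  rewrite mulmx_block !mul1mx !mul0mx !addr0 mulmx1 mulNmx mul_mx_scalar mul_scalar_mx.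
  rewrite addNr det_ublock det_scalar /char_poly /char_poly_mx map_mxM.
  by rewrite mulNmx addrC.
by rewrite det_mulmx det_lblock det1 mul1r det_scalar e1.
Qed.

Variable R : realType.
Local Notation C := R[i].

Lemma specP d (M : 'M[C]_d) : char_poly M = \prod_(z <- spec M) ('X - z%:P).
Proof.
rewrite /spec; case: classical_sets.xgetP => [rs -> //|none].
have [r er] := closed_field_poly_normal (char_poly M).
case: (none r); rewrite /= {1}er.
by rewrite (monicP (char_poly_monic _)) scale1r.
Qed.

(** A factorisation into monic linear factors is unique up to order; the powers of [X] become
    padding zeros. *)
Lemma perm_spec d (M : 'M[C]_d) a b s :
  'X^a * char_poly M = 'X^b * \prod_(z <- s) ('X - z%:P) ->
  perm_eq (nseq a 0 ++ spec M) (nseq b 0 ++ s).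
Proof.
have X k : 'X^k = \prod_(z <- nseq k 0) ('X - z%:P) :> {poly C}.
  by rewrite big_nseq subr0 iter_mulr_1.
by rewrite specP !X -!big_cat => /prod_XsubC_eq.
Qed.

(** Since [xlog2x 0 = 0], the entropy does not see the padding zeros. *)
Lemma ventropy_seq d (M : 'M[C]_d) a b s :
  'X^a * char_poly M = 'X^b * \prod_(z <- s) ('X - z%:P) ->
  ventropy M = - \sum_(z <- s) xlog2x (complex.Re z).
Proof.
move=> /perm_spec h; rewrite /ventropy; congr (- _).
have /= := perm_big _ h (op := +%R) (x := 0) (P := xpredT) (F := fun z => xlog2x (complex.Re z)).
have z k : \sum_(z <- nseq k (0 : C)) xlog2x (complex.Re z) = 0.
  by rewrite big_nseq iter_addr /xlog2x eqxx mul0rn addr0.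
by rewrite !big_cat /= !z !add0r.
Qed.

(** The source of all dualities below: complementary marginals of a pure vector with amplitude
    matrix [A] are [A A^dag] and, up to transposition, [A^dag A]. *)
Lemma ventropy_mulC m n (A : 'M[C]_(m, n)) (B : 'M[C]_(n, m)) :
  ventropy (A *m B) = ventropy (B *m A).
Proof.
have := char_poly_mulC A B; rewrite [in RHS]specP => /ventropy_seq ->.
by [].
Qed.

Lemma ventropy_tr n (A : 'M[C]_n) : ventropy A^T = ventropy A.
Proof.
rewrite (@ventropy_seq _ A^T 0 0 (spec A)) // -specP; congr (_ * _).
rewrite /char_poly -[RHS]det_tr; congr (\det _).
by rewrite /char_poly_mx !(map_trmx, linearB) /= tr_scalar_mx map_trmx.
Qed.

Definition rdiag n (p : 'I_n -> R) : 'M[C]_n := diag_mx (\row_i (p i)%:C).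

Lemma ventropy_rdiag n (p : 'I_n -> R) :
  ventropy (rdiag p) = - \sum_i xlog2x (p i).
Proof.
rewrite (@ventropy_seq _ _ 0 0 [seq (p i)%:C | i <- index_enum 'I_n]) ?big_map //.
congr (_ * _); rewrite char_poly_trig ?diag_mx_is_trig //.
by apply: eq_bigr => i _; rewrite !mxE eqxx.
Qed.

(** The rows of [U] are orthonormal but need not span the space; the missing directions carry
    eigenvalue 0. *)
Lemma ventropy_decomp n k (U : 'M[C]_(k, n)) p :
  U *m adjmx U = 1%:M -> ventropy (adjmx U *m rdiag p *m U) = - \sum_i xlog2x (p i).
Proof. by move=> h; rewrite -mulmxA ventropy_mulC -mulmxA h mulmx1 ventropy_rdiag. Qed.

Lemma conj_rC (x : R) : ((x%:C : C)^*)%R = x%:C.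
Proof. exact: conjc_real. Qed.

Lemma adjmxE m n (M : 'M[C]_(m, n)) i j : adjmx M i j = ((M j i)^*)%R.
Proof. by rewrite !mxE. Qed.

Lemma adjmxK m n (M : 'M[C]_(m, n)) : adjmx (adjmx M) = M.
Proof. by apply/matrixP => i j; rewrite !adjmxE conjCK. Qed.

Lemma adjmxM m n p (M : 'M[C]_(m, n)) (N : 'M[C]_(n, p)) :
  adjmx (M *m N) = adjmx N *m adjmx M.
Proof. by rewrite /adjmx map_mxM trmx_mul. Qed.

Lemma adjmx1 n : adjmx (1%:M : 'M[C]_n) = 1%:M.
Proof. by rewrite /adjmx map_mx1 trmx1. Qed.

Lemma adjmxB m n (M N : 'M[C]_(m, n)) : adjmx (M - N) = adjmx M - adjmx N.
Proof. by rewrite /adjmx map_mxB linearB. Qed.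

Lemma adjmx_sum m n I r P (F : I -> 'M[C]_(m, n)) :
  adjmx (\sum_(i <- r | P i) F i) = \sum_(i <- r | P i) adjmx (F i).
Proof. by rewrite /adjmx raddf_sum linear_sum. Qed.

Lemma adjmx_rdiag n (p : 'I_n -> R) : adjmx (rdiag p) = rdiag p.
Proof.
apply/matrixP => i j; rewrite adjmxE !mxE eq_sym.
by case: eqP => [->|_] /=; rewrite ?mulr1n ?mulr0n ?conjC0 ?conj_rC.
Qed.

Lemma rdiagM n (p q : 'I_n -> R) : rdiag p *m rdiag q = rdiag (fun i => p i * q i).
Proof.
rewrite /rdiag mul_diag_mx; apply/matrixP => i j; rewrite !mxE.
by case: eqP => [->|_]; rewrite ?mulr1n ?mulr0n ?mulr0 // rmorphM.
Qed.

Lemma quad_rdiag n (p : 'I_n -> R) (v : 'cV[C]_n) :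
  (adjmx v *m rdiag p *m v) 0 0 = \sum_i (p i)%:C * (`|v i 0| ^+ 2).
Proof.
rewrite -mulmxA mxE; apply: eq_bigr => i _.
by rewrite /rdiag mul_diag_mx adjmxE !mxE normCKC; ring.
Qed.

Lemma psd_rdiag n (p : 'I_n -> R) : (forall i, 0 <= p i) -> psdmx (rdiag p).
Proof.
move=> p0; split=> [|v]; first exact: adjmx_rdiag.
rewrite quad_rdiag sumr_ge0 // => i _.
by rewrite mulr_ge0 ?exprn_ge0 // lecR.
Qed.

Lemma psd_conj m n (M : 'M[C]_m) (K : 'M[C]_(m, n)) : psdmx M -> psdmx (adjmx K *m M *m K).
Proof.
move=> [h p]; split=> [|v]; first by rewrite !adjmxM adjmxK h mulmxA.
by have := p (K *m v); rewrite adjmxM !mulmxA.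
Qed.

Lemma psd_gram m n (K : 'M[C]_(m, n)) : psdmx (adjmx K *m K).
Proof.
have -> : adjmx K *m K = adjmx K *m rdiag (fun=> 1) *m K.
  rewrite /rdiag (_ : \row__ _ = const_mx 1) ?diag_const_mx ?mulmx1 //.
  by apply/rowP => i; rewrite !mxE.
by apply/psd_conj/psd_rdiag => i; exact: ler01.
Qed.

Lemma psd_spectral n (M : 'M[C]_n) : psdmx M ->
  exists (U : 'M[C]_n) (p : 'I_n -> R),
    [/\ U *m adjmx U = 1%:M, adjmx U *m U = 1%:M, forall i, 0 <= p i &
        M = adjmx U *m rdiag p *m U].
Proof.
move=> [hM pM].
have adjE m k (N : 'M[C]_(m, k)) : adjmx N = map_mx Num.conj N^T by rewrite /adjmx map_trmx.
have /hermitian_normalmx/orthomx_spectralP : M \is hermsymmx.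
  by apply/is_hermitianmxP; rewrite expr0 scale1r -adjE.
set U := spectralmx M; set s := spectral_diag M.
have uU : U \is unitarymx by exact: spectral_unitarymx.
rewrite invmx_unitary // -adjE => eM.
have U1 : U *m adjmx U = 1%:M by rewrite adjE; apply/unitarymxP.
have U2 : adjmx U *m U = 1%:M by apply: mulmx1C.
(* Each eigenvalue is the quadratic form of [M] at the matching column of [U^dag]. *)
have s0 i : 0 <= s 0 i.
  have := pM (col i (adjmx U)).
  have -> : adjmx (col i (adjmx U)) = row i U.
    by apply/matrixP => a b; rewrite adjmxE !mxE conjCK.
  rewrite -row_mul; congr (0 <= _).
  have -> : s 0 i = (U *m M *m adjmx U) i i.
    by rewrite eM !mulmxA U1 mul1mx -mulmxA U1 mulmx1 !mxE eqxx.
  by rewrite mxE [RHS]mxE; apply: eq_bigr => k _; rewrite !mxE.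
exists U, (fun i => complex.Re (s 0 i)); split; [exact: U1|exact: U2|move=> i|].
  by have := s0 i; rewrite lecE /= => /andP[].
rewrite {1}eM; congr (_ *m _ *m _); congr diag_mx; apply/rowP => i.
by rewrite !mxE RRe_real // ger0_real.
Qed.

(** [sqrtm] picks some positive square root, so it suffices to exhibit one: take roots of the
    eigenvalues. *)
Lemma psd_sqrt n (M : 'M[C]_n) : psdmx M -> psdmx (sqrtm M) /\ sqrtm M *m sqrtm M = M.
Proof.
move=> pM; rewrite /sqrtm; case: classical_sets.xgetP => [Y -> //|none].
have [U [p [U1 U2 p0 eM]]] := psd_spectral pM.
case: (none (adjmx U *m rdiag (fun i => Num.sqrt (p i)) *m U)); split.
  by apply/psd_conj/psd_rdiag => i; exact: sqrtr_ge0.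
rewrite !mulmxA -[_ *m U *m adjmx U]mulmxA U1 mulmx1 -[_ *m rdiag _ *m rdiag _]mulmxA.
rewrite rdiagM eM; congr (_ *m rdiag _ *m _); apply/funext => i.
by rewrite -expr2 sqr_sqrtr.
Qed.

Lemma psd_factor n (M : 'M[C]_n) : psdmx M -> exists K : 'M[C]_n, M = adjmx K *m K.
Proof. by move=> /psd_sqrt [[h _] e]; exists (sqrtm M); rewrite h e. Qed.

Lemma mxtrace_gram m n (K L : 'M[C]_(m, n)) :
  \tr (adjmx K *m L) = \sum_i \sum_j ((K j i)^*)%R * L j i.
Proof. by apply: eq_bigr => i _; rewrite mxE; apply: eq_bigr => j _; rewrite adjmxE. Qed.

Lemma mxtrace_gram_ge0 m n (K : 'M[C]_(m, n)) : 0 <= \tr (adjmx K *m K).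
Proof.
rewrite mxtrace_gram; apply: sumr_ge0 => i _; apply: sumr_ge0 => j _.
by rewrite -normCKC exprn_ge0.
Qed.

Lemma mxtrace_gram_eq0 m n (K : 'M[C]_(m, n)) : \tr (adjmx K *m K) = 0 -> K = 0.
Proof.
rewrite mxtrace_gram pair_big /= => h; apply/matrixP => j i; rewrite mxE.
have /(_ (i, j) isT)/eqP : forall p, true -> (K p.2 p.1)^*%R * K p.2 p.1 = 0.
  by apply: psumr_eq0P h => k _; rewrite -normCKC exprn_ge0.
by rewrite /= -normCKC sqrf_eq0 normr_eq0 => /eqP.
Qed.

(** With [M = K^dag K] and [N = L^dag L], the trace is the squared Hilbert-Schmidt norm of
    [K L^dag]. *)
Lemma psd_mxtrace_ge0 n (M N : 'M[C]_n) : psdmx M -> psdmx N -> 0 <= \tr (M *m N).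
Proof.
move=> /psd_factor [K ->] /psd_factor [L ->].
rewrite mulmxA mxtrace_mulC !mulmxA -mulmxA -[L *m _]adjmxK adjmxM adjmxK.
exact: mxtrace_gram_ge0.
Qed.

Lemma psd_sum n I r (P : pred I) (F : I -> 'M[C]_n) :
  (forall i, P i -> psdmx (F i)) -> psdmx (\sum_(i <- r | P i) F i).
Proof.
move=> h; apply: (big_ind (@psdmx _ n)) => //; last first.
  move=> M N [hM pM] [hN pN]; split=> [|v].
    by rewrite -{2}hM -{2}hN /adjmx map_mxD linearD.
  by rewrite mulmxDr mulmxDl mxE addr_ge0.
split=> [|v]; first by rewrite /adjmx map_mx0 trmx0.
by rewrite mulmx0 mul0mx mxE.
Qed.

Lemma le_bigmax_seq (s : seq C) z : z \in s ->
  complex.Re z <= \big[Num.max/0]_(z <- s) complex.Re z.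
Proof.
elim: s => // y s IH; rewrite inE big_cons le_max => /orP[/eqP->|/IH->]; rewrite ?lexx //.
by rewrite orbT.
Qed.

(** [opnorm] is read off the spectrum of [M^dag M], which contains the squares of the eigenvalues
    [p i] of [M]; hence every [p i] is at most [opnorm M]. *)
Lemma psd_opnorm_sub n (M : 'M[C]_n) : psdmx M -> psdmx ((opnorm M)%:C%:M - M).
Proof.
move=> pM; have [U [p [U1 U2 p0 eM]]] := psd_spectral pM.
have hp i : p i <= opnorm M.
  have e : adjmx M *m M = adjmx U *m rdiag (fun i => p i * p i) *m U.
    case: pM => -> _; rewrite {1 2}eM !mulmxA -[_ *m U *m adjmx U]mulmxA U1 mulmx1.
    by rewrite -[_ *m rdiag _ *m rdiag _]mulmxA rdiagM.
  have h : ((p i * p i)%:C : C) \in spec (adjmx M *m M).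
    have := @perm_spec _ (adjmx M *m M) 0 0 [seq (p i * p i)%:C | i <- index_enum 'I_n].
    rewrite !mul1r big_map => /(_ _)/perm_mem/= ->.
      by apply/mapP; exists i; rewrite ?mem_index_enum.
    have := char_poly_mulC (adjmx U) (rdiag (fun i => p i * p i) *m U).
    move/(mulfI (monic_neq0 (monicXn _ _))); rewrite mulmxA -e => ->.
    rewrite -mulmxA U1 mulmx1 char_poly_trig ?diag_mx_is_trig //.
    by apply: eq_bigr => j _; rewrite !mxE eqxx.
  rewrite -(ger0_norm (p0 i)) -sqrtr_sqr /opnorm ler_wsqrtr // expr2.
  exact: (le_bigmax_seq h).
have -> : (opnorm M)%:C%:M - M = adjmx U *m rdiag (fun i => opnorm M - p i) *m U.
  have -> : rdiag (fun i => opnorm M - p i) = (opnorm M)%:C%:M - rdiag p.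
    apply/matrixP => i j; rewrite !mxE.
    by case: eqP => _; rewrite ?mulr1n ?mulr0n ?subr0 // rmorphB.
  by rewrite mulmxBr mulmxBl mul_mx_scalar -scalemxAl U2 -eM scalemx1.
by apply/psd_conj/psd_rdiag => i; rewrite subr_ge0.
Qed.

Lemma opnorm_ge0 n (M : 'M[C]_n) : 0 <= opnorm M.
Proof. exact: sqrtr_ge0. Qed.
End MatrixEntropy.

(** * The measured-state bound for matrices *)

Section Overlaps.
Set Implicit Arguments. Unset Strict Implicit. Unset Printing Implicit Defensive.
Local Open Scope complex_scope.
Variable R : realType.
Local Notation C := R[i].

(* Locked: otherwise unification exposes [complex.Re (z * z)] as a difference of
   products, to which distributivity lemmas apply. *)
Definition nsq : C -> R := locked (fun z => complex.Re (`|z| ^+ 2)).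

Lemma nsqE z : (nsq z)%:C = (z^*)%R * z.
Proof. by rewrite /nsq -lock -normCKC RRe_real // ger0_real // exprn_ge0. Qed.

Lemma nsq_ge0 z : 0 <= nsq z.
Proof. by rewrite -lecR nsqE -normCKC exprn_ge0. Qed.

Lemma nsq_conj (z : C) : nsq z^*%R = nsq z.
Proof. by rewrite /nsq -lock norm_conjC. Qed.

Lemma nsqM (z : C) (x : R) : nsq (z * x%:C) = nsq z * x ^+ 2.
Proof.
apply: complexI; rewrite [RHS]rmorphM rmorphXn /= !nsqE rmorphM /= conj_rC; ring.
Qed.

Lemma rdiag_conj_diag m n (A : 'M[C]_(m, n)) p j :
  (A *m rdiag p *m adjmx A) j j = (\sum_i p i * nsq (A j i))%:C.
Proof.
rewrite mxE rmorph_sum /=; apply: eq_bigr => i _.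
by rewrite /rdiag mul_mx_diag adjmxE !mxE rmorphM /= nsqE; ring.
Qed.

Lemma gram_diag m n (A : 'M[C]_(m, n)) i :
  (adjmx A *m A) i i = (\sum_j nsq (A j i))%:C.
Proof. by rewrite mxE rmorph_sum /=; apply: eq_bigr => j _; rewrite adjmxE nsqE. Qed.

Lemma mxtrace_rdiag_gram m n (p : 'I_n -> R) (A B : 'M[C]_(m, n)) :
  \tr (rdiag p *m adjmx A *m B) = \sum_i \sum_j (p i)%:C * ((A j i)^*%R * B j i).
Proof.
apply: eq_bigr => i _; rewrite mxE; apply: eq_bigr => j _.
by rewrite /rdiag mul_diag_mx !mxE mulrA.
Qed.

Lemma mxtrace_rdiag_gramr m n (p : 'I_n -> R) (A : 'M[C]_(m, n)) :
  \tr (rdiag p *m adjmx A *m A) = (\sum_i \sum_j p i * nsq (A j i))%:C.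
Proof.
rewrite mxtrace_rdiag_gram rmorph_sum /=; apply: eq_bigr => i _.
by rewrite rmorph_sum /=; apply: eq_bigr => j _; rewrite rmorphM /= nsqE.
Qed.

Lemma mxtrace_mul_inj n (A B : 'M[C]_n) :
  (forall Y, \tr (A *m Y) = \tr (B *m Y)) -> A = B.
Proof.
have e (M : 'M[C]_n) i j : \tr (M *m delta_mx j i) = M i j.
  rewrite -(mul_delta_mx (0 : 'I_1)) mulmxA mxtrace_mulC -rowE -colE trace_mx11.
  by rewrite !mxE.
by move=> h; apply/matrixP => i j; rewrite -!e.
Qed.

Lemma psd_spectral_fam (I : finType) n (M : I -> 'M[C]_n) : (forall i, psdmx (M i)) ->
  exists (U : I -> 'M[C]_n) (p : I -> 'I_n -> R),
    forall i, [/\ U i *m adjmx (U i) = 1%:M, adjmx (U i) *m U i = 1%:M,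
      forall k, 0 <= p i k & M i = adjmx (U i) *m rdiag (p i) *m U i].
Proof.
move=> h.
have /choice [f hf] : forall i, exists Up : 'M[C]_n * ('I_n -> R),
    [/\ Up.1 *m adjmx Up.1 = 1%:M, adjmx Up.1 *m Up.1 = 1%:M,
      forall k, 0 <= Up.2 k & M i = adjmx Up.1 *m rdiag Up.2 *m Up.1].
  by move=> i; have [U [p ?]] := psd_spectral (h i); exists (U, p).
by exists (fun i => (f i).1), (fun i => (f i).2).
Qed.

Lemma kadison (I : finType) n (X K : I -> 'M[C]_n) :
  (forall k, psdmx (X k)) -> \sum_k X k = 1%:M ->
  let Phi := \sum_k X k *m K k in
  psdmx (\sum_k adjmx (K k) *m X k *m K k - adjmx Phi *m Phi).
Proof.
move=> pX X1 Phi.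
(* The difference is a sum of squares because [sum_k X k = 1]. *)
suff -> : \sum_k adjmx (K k) *m X k *m K k - adjmx Phi *m Phi =
    \sum_k adjmx (K k - Phi) *m X k *m (K k - Phi).
  by apply: psd_sum => k _; exact: psd_conj.
have aPhi : \sum_k adjmx (K k) *m X k = adjmx Phi.
  rewrite /Phi adjmx_sum; apply: eq_bigr => k _.
  by rewrite adjmxM (pX k).1.
have e1 : \sum_k adjmx (K k) *m X k *m Phi = adjmx Phi *m Phi.
  by rewrite -mulmx_suml aPhi.
have e2 : \sum_k adjmx Phi *m X k *m K k = adjmx Phi *m Phi.
  by rewrite {3}/Phi mulmx_sumr; apply: eq_bigr => k _; rewrite mulmxA.
have e3 : \sum_k adjmx Phi *m X k *m Phi = adjmx Phi *m Phi.
  by rewrite -mulmx_suml -mulmx_sumr X1 mulmx1.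
under [RHS]eq_bigr do rewrite adjmxB !(mulmxBl, mulmxBr).
by rewrite !sumrB e1 e2 e3 subrr subr0.
Qed.

(** With [d = u q + (1 - u) p], the right side minus the left is [d |T - p a / d|^2]. *)
Lemma complete_square (p q u : R) (a T : C) : 0 <= p -> 0 <= q -> 0 < u < 1 ->
  (p%:C : C) * (a^*%R * T + a * T^*%R) -
  (u%:C * q%:C * (T^*%R * T) + (1 - u)%:C * p%:C * (T^*%R * T))
  <= (p * nsq a * (p / (u * q + (1 - u) * p)))%:C.
Proof.
move=> p0 q0 /andP[u0 u1]; set d := u * q + _.
have d0 : 0 <= d by rewrite /d; nra.
have -> : u%:C * q%:C * (T^*%R * T) + (1 - u)%:C * p%:C * (T^*%R * T) = d%:C * (T^*%R * T).
  by rewrite /d !rmorphD /= !rmorphM !rmorphD /=; ring.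
(* As [u < 1], a vanishing [d] forces [p = 0], and then both sides are 0. *)
have [dE|dN] := eqVneq d 0.
  have -> : p = 0 by move: dE; rewrite /d => ?; nra.
  by rewrite dE !(rmorph0, mul0r) subr0.
rewrite -subr_ge0 !rmorphM /= nsqE fmorphV /=.
have dC : (d%:C : C) != 0 by rewrite -[0]/(0%:C) (inj_eq (@complexI R)).
set z := T - p%:C / d%:C * a.
suff -> : p%:C * (a^*%R * a) * (p%:C / d%:C) - (p%:C * (a^*%R * T + a * T^*%R) - d%:C * (T^*%R * T))
   = d%:C * (z^*%R * z) :> C.
  by rewrite -normCKC mulr_ge0 ?exprn_ge0 // lecR.
rewrite /z rmorphB !rmorphM /= fmorphV /= !conj_rC; field.
exact: dC.
Qed.
End Overlaps.

(** * Lifting memory operators to test operators *)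

Section Lifting.
Set Implicit Arguments. Unset Strict Implicit. Unset Printing Implicit Defensive.
Local Open Scope complex_scope.
Variable R : realType.
Local Notation C := R[i].

Variables (Ox Oz : finType) (N b : nat).
Variables (rho : 'M[C]_N) (X : Ox -> 'M[C]_N) (Z : Oz -> 'M[C]_N).
Variables (pi : 'M[C]_b -> 'M[C]_N) (rB : 'M[C]_b) (rX : Ox -> 'M[C]_b).
Variable h : Ox -> R.
Hypothesis prho : psdmx rho.
Hypothesis pX : forall k, psdmx (X k).
Hypothesis X1 : \sum_k X k = 1%:M.
Hypothesis hZ : forall l, adjmx (Z l) = Z l.
Hypothesis piM : forall Y Y', pi (Y *m Y') = pi Y *m pi Y'.
Hypothesis piA : forall Y, pi (adjmx Y) = adjmx (pi Y).
Hypothesis piX : forall k Y, X k *m pi Y = pi Y *m X k.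
Hypothesis piZ : forall l Y, Z l *m pi Y = pi Y *m Z l.
Hypothesis trB : forall Y, \tr (rB *m Y) = \tr (rho *m pi Y).
Hypothesis trX : forall k Y, \tr (rX k *m Y) = \tr (rho *m X k *m pi Y).
Hypothesis hX : forall k,
  psdmx ((h k)%:C%:M - \sum_l Z l *m X k *m Z l).

(** The test operator [Phi]. Here [pi] abstracts the embedding [Y -> 1 (x) Y (x) 1] as a
    multiplicative, adjoint-preserving map commuting with all [X k] and [Z l]; [rB] and [rX k] are
    the marginal and the unnormalised conditional states of the memory. *)
Definition liftY (Y : Ox -> 'M[C]_b) := \sum_k X k *m pi (Y k).

Lemma tr_liftY Y : \tr (rho *m liftY Y) = \sum_k \tr (rX k *m Y k).
Proof.
rewrite mulmx_sumr raddf_sum; apply: eq_bigr => k _.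
by rewrite trX mulmxA.
Qed.

(** Kadison-Schwarz for [Phi] is paired with the positive [rho]; since [pi] commutes with [X k],
    [trX] brings each term back to the memory. *)
Lemma tr_liftY_gram Y :
  \tr (rho *m (adjmx (liftY Y) *m liftY Y)) <= \sum_k \tr (rX k *m (adjmx (Y k) *m Y k)).
Proof.
have := psd_mxtrace_ge0 prho (kadison (fun k => pi (Y k)) pX X1).
rewrite mulmxBr linearB /= subr_ge0 => /le_trans; apply.
rewrite mulmx_sumr raddf_sum le_eqVlt; apply/orP; left; apply/eqP; apply: eq_bigr => k _.
by rewrite trX piM piA -piA -[in RHS]mulmxA (mulmxA (X k)) piX.
Qed.

Lemma adj_liftY Y : adjmx (liftY Y) = liftY (fun k => adjmx (Y k)).
Proof.
rewrite /liftY adjmx_sum; apply: eq_bigr => k _.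
by rewrite adjmxM (pX k).1 -piA piX.
Qed.

(** Here Kadison-Schwarz is applied to [Phi^dag]. Summing over [l] produces [sum_l Z_l X_k Z_l],
    which [hX] bounds by [h k], and [trB] returns to the memory. This is where the overlap constants
    enter. *)
Lemma tr_liftY_gramr Y :
  \sum_l \tr (Z l *m rho *m Z l *m (liftY Y *m adjmx (liftY Y))) <=
  \sum_k (h k)%:C * \tr (rB *m (Y k *m adjmx (Y k))).
Proof.
have h1 l : \tr (Z l *m rho *m Z l *m (liftY Y *m adjmx (liftY Y))) <=
   \sum_k \tr (Z l *m rho *m Z l *m (pi (Y k) *m X k *m pi (adjmx (Y k)))).
  have pl : psdmx (Z l *m rho *m Z l) by rewrite -{1}hZ; exact: psd_conj.
  have := psd_mxtrace_ge0 pl (kadison (fun k => pi (adjmx (Y k))) pX X1).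
  rewrite -[\sum_k X k *m pi (adjmx (Y k))]adj_liftY adjmxK.
  rewrite mulmxBr linearB /= subr_ge0 => /le_trans; apply.
  rewrite mulmx_sumr raddf_sum le_eqVlt; apply/orP; left; apply/eqP.
  by apply: eq_bigr => k _; rewrite -piA adjmxK.
apply: (le_trans (ler_sum _ (fun l _ => h1 l))).
rewrite exchange_big /=; apply: ler_sum => k _.
(* The outer [Z l] goes around the trace, and both copies commute past the [pi] factors until they
   surround [X k]. *)
have -> : \sum_l \tr (Z l *m rho *m Z l *m (pi (Y k) *m X k *m pi (adjmx (Y k)))) =
    \tr (rho *m (pi (Y k) *m (\sum_l Z l *m X k *m Z l) *m pi (adjmx (Y k)))).
  rewrite mulmx_sumr mulmx_suml mulmx_sumr raddf_sum; apply: eq_bigr => l _ /=.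
  rewrite -!(mulmxA (Z l)) mxtrace_mulC; congr (\tr _).
  by rewrite -!mulmxA -piZ !mulmxA -[in RHS](mulmxA rho) -piZ !mulmxA.
have := psd_mxtrace_ge0 prho (psd_conj (adjmx (pi (Y k))) (hX k)).
rewrite adjmxK -piA mulmxBr mulmxBl mulmxBr linearB /= subr_ge0 => /le_trans; apply.
by rewrite mul_mx_scalar -scalemxAl -scalemxAr mxtraceZ -piM trB.
Qed.
End Lifting.

(** * Test values and suprema in eigenbases *)

Section SpectralBounds.
Set Implicit Arguments. Unset Strict Implicit. Unset Printing Implicit Defensive.
Local Open Scope complex_scope.
Variable R : realType.
Local Notation C := R[i].

(** The value of a test operator never exceeds [Q_u] of the measured state and its pinching. Their
    eigenvalues are [p i] and [q l s], with overlaps given by [a]; [T] holds the entries of the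
    lifted [Phi] in these eigenbases. Once all traces are sums over [(l, i, s)], [complete_square]
    applies term by term. *)
Lemma in_bound (Oz : finType) N (rho : 'M[C]_N) (W : Oz -> 'M[C]_N) (U : 'M[C]_N) p
    (V : Oz -> 'M[C]_N) q
    (Phi : 'M[C]_N) (u Q : R) :
  (forall l, adjmx (W l) = W l) -> \sum_l W l *m W l = 1%:M ->
  [/\ U *m adjmx U = 1%:M, adjmx U *m U = 1%:M, forall i, 0 <= p i &
      rho = adjmx U *m rdiag p *m U] ->
  (forall l, [/\ V l *m adjmx (V l) = 1%:M, adjmx (V l) *m V l = 1%:M,
      forall i, 0 <= q l i & W l *m rho *m W l = adjmx (V l) *m rdiag (q l) *m V l]) ->
  0 < u < 1 -> \tr (rho *m Phi) = Q%:C ->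
  2 * Q%:C - (u%:C * (\sum_l \tr (W l *m W l *m rho *m (W l *m W l) *m (Phi *m adjmx Phi)))
    + (1 - u)%:C * \tr (rho *m (adjmx Phi *m Phi))) <=
  (\sum_l \sum_i \sum_s p i * nsq ((V l *m W l *m adjmx U) s i) *
     (p i / (u * q l s + (1 - u) * p i)))%:C.
Proof.
move=> hW W1 [U1 U2 p0 eU] dV u01 trQ.
pose a l := V l *m W l *m adjmx U; pose T l := V l *m W l *m Phi *m adjmx U.
have VV l k (A : 'M_(k, N)) : A *m adjmx (V l) *m V l = A.
  by have [_ V2 _ _] := dV l; rewrite -mulmxA V2 mulmx1.
have UU k (A : 'M_(k, N)) : A *m adjmx U *m U = A by rewrite -mulmxA U2 mulmx1.
have trU A : \tr (rdiag p *m (U *m A *m adjmx U)) = \tr (rho *m A).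
  by rewrite eU mulmxA mxtrace_mulC !mulmxA.
have e6 : \tr (rho *m Phi) = \sum_l \sum_i \sum_s (p i)%:C * ((a l s i)^*%R * T l s i).
  rewrite -[Phi]mul1mx -W1 mulmx_suml mulmx_sumr raddf_sum; apply: eq_bigr => l _ /=.
  rewrite -mxtrace_rdiag_gram -(mulmxA (rdiag p)).
  have -> : adjmx (a l) *m T l = U *m (W l *m W l *m Phi) *m adjmx U.
    by rewrite /a /T !adjmxM adjmxK hW !mulmxA VV.
  by rewrite trU.
have TT l : adjmx (T l) *m T l = U *m (adjmx Phi *m (W l *m W l) *m Phi) *m adjmx U.
  by rewrite /T !adjmxM adjmxK hW !mulmxA VV.
have e7 : \tr (rho *m (adjmx Phi *m Phi)) =
    \sum_l \sum_i \sum_s (p i)%:C * ((T l s i)^*%R * T l s i).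
  rewrite -[adjmx Phi]mulmx1 -W1 mulmx_sumr mulmx_suml mulmx_sumr raddf_sum.
  by apply: eq_bigr => l _ /=; rewrite -mxtrace_rdiag_gram -(mulmxA (rdiag p)) TT trU.
have e8 l : \tr (W l *m W l *m rho *m (W l *m W l) *m (Phi *m adjmx Phi)) =
    \sum_i \sum_s (q l s)%:C * ((T l s i)^*%R * T l s i).
  have -> : W l *m W l *m rho *m (W l *m W l) = W l *m (W l *m rho *m W l) *m W l.
    by rewrite !mulmxA.
  have [_ _ _ ->] := dV l.
  transitivity (\tr (rdiag (q l) *m adjmx (adjmx (T l)) *m adjmx (T l))).
    rewrite adjmxK /T !adjmxM adjmxK hW !mulmxA UU.
    rewrite -[in LHS](mulmxA (W l *m adjmx (V l) *m rdiag (q l) *m V l *m W l)).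
    rewrite -2!(mulmxA (W l *m adjmx (V l) *m rdiag _)) -(mulmxA (W l *m adjmx (V l))).
    by rewrite [LHS]mxtrace_mulC !mulmxA.
  rewrite mxtrace_rdiag_gram exchange_big /=; apply: eq_bigr => i _.
  by apply: eq_bigr => s _; rewrite adjmxE conjCK [X in _ * X]mulrC.
(* The trace is real, so doubling it amounts to adding its conjugate; this yields the cross terms of
   [complete_square]. *)
have -> : 2 * Q%:C = \tr (rho *m Phi) + (\tr (rho *m Phi))^*%R.
  by rewrite trQ conj_rC; ring.
rewrite e6 e7 (eq_bigr _ (fun l _ => e8 l)) !mulr_sumr rmorph_sum.
rewrite -!big_split /= -sumrB rmorph_sum /=.
apply: ler_sum => l _; rewrite !mulr_sumr rmorph_sum -!big_split -sumrB rmorph_sum /=.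
apply: ler_sum => i _; rewrite !mulr_sumr rmorph_sum -!big_split -sumrB rmorph_sum /=.
apply: ler_sum => s _; have [_ _ q0 _] := dV l.
have := complete_square (a l s i) (T l s i) (p0 i) (q0 s) u01.
rewrite !rmorphM /= conj_rC conjCK; apply: le_trans; rewrite le_eqVlt; apply/orP; left; apply/eqP.
by ring.
Qed.

(** At the maximiser of a linear minus a quadratic term, the quadratic form and the linear form both
    equal [Q_u]. The pair consists of [sum_k |k><k| (x) rX k] and [sum_k h_k |k><k| (x) rB]; both
    are block diagonal in [k], so the maximiser is sought blockwise. *)
Lemma out_bound (Ox : finType) b (rB : 'M[C]_b) (rX : Ox -> 'M[C]_b) (h : Ox -> R)
    (G : 'M[C]_b) r (V : Ox -> 'M[C]_b) P (u : R) :
  [/\ G *m adjmx G = 1%:M, adjmx G *m G = 1%:M, forall i, 0 <= r i &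
      rB = adjmx G *m rdiag r *m G] ->
  (forall k, [/\ V k *m adjmx (V k) = 1%:M, adjmx (V k) *m V k = 1%:M,
      forall i, 0 <= P k i & rX k = adjmx (V k) *m rdiag (P k) *m V k]) ->
  let Q := \sum_k \sum_s \sum_j P k s * nsq ((G *m adjmx (V k)) j s) *
     (P k s / (u * (h k * r j) + (1 - u) * P k s)) in
  exists Y : Ox -> 'M[C]_b,
    \sum_k \tr (rX k *m Y k) = Q%:C /\
    u%:C * (\sum_k (h k)%:C * \tr (rB *m (Y k *m adjmx (Y k)))) +
    (1 - u)%:C * (\sum_k \tr (rX k *m (adjmx (Y k) *m Y k))) = Q%:C.
Proof.
move=> [G1 G2 r0 eG] dV Q.
pose a k := G *m adjmx (V k).
pose d k j s := u * (h k * r j) + (1 - u) * P k s.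
(* The test operator attaining the supremum that defines [Q_u]; where [d] vanishes,
   so does [P], and the junk value [P / 0 = 0] is the right one. *)
pose y k : 'M[C]_b := \matrix_(j, s) (a k j s * (P k s / d k j s)%:C).
have yE k j s : y k j s = a k j s * (P k s / d k j s)%:C by rewrite [LHS]mxE.
pose Y k := adjmx G *m y k *m V k.
have V1 k m (A : 'M_(m, b)) : A *m V k *m adjmx (V k) = A.
  by have [V1 _ _ _] := dV k; rewrite -mulmxA V1 mulmx1.
have GG k (A : 'M_(k, b)) : A *m G *m adjmx G = A by rewrite -mulmxA G1 mulmx1.
have trV k A : \tr (rX k *m A) = \tr (rdiag (P k) *m (V k *m A *m adjmx (V k))).
  by have [_ _ _ ->] := dV k; rewrite mulmxA [RHS]mxtrace_mulC !mulmxA.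
have trG A : \tr (rB *m A) = \tr (rdiag r *m (G *m A *m adjmx G)).
  by rewrite eG mulmxA [RHS]mxtrace_mulC !mulmxA.
exists Y; split.
  rewrite rmorph_sum; apply: eq_bigr => k _ /=.
  have -> : \tr (rX k *m Y k) = \tr (rdiag (P k) *m adjmx (a k) *m y k).
    by rewrite trV /Y !mulmxA V1 /a adjmxM adjmxK !mulmxA.
  rewrite mxtrace_rdiag_gram rmorph_sum; apply: eq_bigr => s _ /=.
  rewrite rmorph_sum; apply: eq_bigr => j _ /=.
  rewrite yE [X in _ * X]mulrA -nsqE -!rmorphM /=; congr (_%:C); rewrite /d /a; ring.
rewrite !mulr_sumr -big_split rmorph_sum /=; apply: eq_bigr => k _.
have -> : \tr (rX k *m (adjmx (Y k) *m Y k)) = \tr (rdiag (P k) *m adjmx (y k) *m y k).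
  by rewrite trV /Y !adjmxM adjmxK !mulmxA V1 (V1 _ _ (rdiag _)) GG.
have -> : \tr (rB *m (Y k *m adjmx (Y k))) =
    \tr (rdiag r *m adjmx (adjmx (y k)) *m adjmx (y k)).
  by rewrite trG /Y !adjmxM !adjmxK !mulmxA GG (GG _ (rdiag _)) V1.
rewrite !mxtrace_rdiag_gramr exchange_big /= -!rmorphM -rmorphD /=; congr (_%:C).
rewrite !mulr_sumr -big_split; apply: eq_bigr => s _ /=.
rewrite !mulr_sumr -big_split; apply: eq_bigr => j _ /=.
rewrite adjmxE nsq_conj yE nsqM -/(d k j s).
have [dE|dN] := eqVneq (d k j s) 0; first by rewrite dE invr0 !mulr0 expr2 !mul0r !mulr0 addr0.
set x := nsq _ * _; have -> : u * (h k * (r j * x)) + (1 - u) * (P k s * x) = d k j s * x.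
  by rewrite /d; ring.
rewrite /x -/(a k) -/(d k j s); move: dN; set e := d k j s => dN.
by field.
Qed.
End SpectralBounds.

(** * From test operators to entropies *)

Section MeasuredEntropy.
Set Implicit Arguments. Unset Strict Implicit. Unset Printing Implicit Defensive.
Local Open Scope complex_scope.
Variable R : realType.
Local Notation C := R[i].

Lemma xlog2xE (x : R) : xlog2x x = x * ln x / ln 2.
Proof. by rewrite /xlog2x /log2; case: eqP => [->|_]; rewrite ?mul0r // mulrA. Qed.

Lemma tr_rdiag n (p : 'I_n -> R) : complex.Re (\tr (rdiag p)) = \sum_i p i.
Proof.
rewrite mxtrace_diag (eq_bigr (fun i => (p i)%:C)) => [|i _]; last by rewrite mxE.
by rewrite -(rmorph_sum (real_complex R)).
Qed.

(** Rearranged, this compares two relative entropies: that of [rho_XB] to [sum_k h_k |k><k| (x) rB]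
    is at most that of the measured state to its pinching. [W l] plays the square root of a POVM
    element. *)
Theorem measured_entropy_bound (Ox Oz : finType) (N b : nat)
  (rho : 'M[C]_N) (X : Ox -> 'M[C]_N) (W : Oz -> 'M[C]_N)
  (pi : 'M[C]_b -> 'M[C]_N) (rB : 'M[C]_b) (rX : Ox -> 'M[C]_b) (h : Ox -> R) :
  psdmx rho -> (forall k, psdmx (X k)) -> \sum_k X k = 1%:M ->
  (forall l, adjmx (W l) = W l) -> \sum_l W l *m W l = 1%:M ->
  pi 1%:M = 1%:M -> (forall Y Y', pi (Y *m Y') = pi Y *m pi Y') ->
  (forall Y, pi (adjmx Y) = adjmx (pi Y)) ->
  (forall k Y, X k *m pi Y = pi Y *m X k) ->
  (forall l Y, W l *m pi Y = pi Y *m W l) ->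
  psdmx rB -> (forall k, psdmx (rX k)) ->
  (forall Y, \tr (rB *m Y) = \tr (rho *m pi Y)) ->
  (forall k Y, \tr (rX k *m Y) = \tr (rho *m X k *m pi Y)) ->
  (forall k, 0 <= h k) -> (forall k, h k = 0 -> rX k = 0) ->
  (forall k, psdmx ((h k)%:C%:M - \sum_l W l *m W l *m X k *m (W l *m W l))) ->
  - \sum_k complex.Re (\tr (rX k)) * log2 (h k) <=
  \sum_k ventropy (rX k) - ventropy rB +
  (\sum_l ventropy (W l *m rho *m W l) - ventropy rho).
Proof.
move=> prho pX X1 hW W1 pi1 piM piA piX piW prB prX trB trX h0 hX0 hX.
have pW l : psdmx (W l *m rho *m W l) by rewrite -{1}hW; exact: psd_conj.
have [U [p dU]] := psd_spectral prho; have [U1 U2 p0 eU] := dU.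
have [V [q dV]] := psd_spectral_fam pW.
have [G [r dG]] := psd_spectral prB; have [G1 G2 r0 eG] := dG.
have [V' [P dV']] := psd_spectral_fam prX.
pose a l := V l *m W l *m adjmx U; pose c k := G *m adjmx (V' k).
have sumX : \sum_k rX k = rB.
  apply: mxtrace_mul_inj => Y; rewrite mulmx_suml raddf_sum trB -[pi Y]mul1mx -X1.
  rewrite mulmx_suml mulmx_sumr raddf_sum; apply: eq_bigr => k _ /=.
  by rewrite trX mulmxA.
(* The facts [a1], [aq], [c1], [cr] give the marginals of the weights [w] and [w'] below: [p] and
   [q] for the first, [P] and [r] for the second. *)
have a1 i : \sum_l \sum_s nsq (a l s i) = 1.
  apply: (@complexI R); rewrite rmorph_sum rmorph1 /=.
  under eq_bigr do rewrite -gram_diag.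
  rewrite -summxE (_ : \sum_l _ = 1%:M) ?mxE ?eqxx //.
  under eq_bigr => l _.
    rewrite /a !adjmxM adjmxK hW !mulmxA; have [_ V2 _ _] := dV l.
    rewrite -(mulmxA _ (adjmx (V l))) V2 mulmx1; over.
  rewrite -mulmx_suml.
  under eq_bigr do rewrite -mulmxA.
  by rewrite -mulmx_sumr W1 mulmx1 U1.
have aq l s : \sum_i p i * nsq (a l s i) = q l s.
  apply: (@complexI R); rewrite -rdiag_conj_diag.
  have [V1 _ _ eV] := dV l.
  have -> : a l *m rdiag p *m adjmx (a l) = V l *m (W l *m rho *m W l) *m adjmx (V l).
    by rewrite /a !adjmxM adjmxK hW eU !mulmxA.
  by rewrite eV !mulmxA V1 mul1mx -mulmxA V1 mulmx1 !mxE eqxx.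
have c1 k s : \sum_j nsq (c k j s) = 1.
  apply: (@complexI R); rewrite rmorph1 -gram_diag; have [V1 _ _ _] := dV' k.
  by rewrite /c adjmxM adjmxK mulmxA -(mulmxA (V' k)) G2 mulmx1 V1 mxE eqxx.
have cr j : \sum_k \sum_s P k s * nsq (c k j s) = r j.
  apply: (@complexI R); rewrite rmorph_sum /=.
  under eq_bigr do rewrite -rdiag_conj_diag.
  rewrite -summxE (_ : \sum_k _ = rdiag r) ?mxE ?eqxx //.
  transitivity (G *m rB *m adjmx G); last by rewrite eG !mulmxA G1 mul1mx -mulmxA G1 mulmx1.
  rewrite -sumX mulmx_sumr mulmx_suml; apply: eq_bigr => k _.
  by have [_ _ _ ->] := dV' k; rewrite /c adjmxM adjmxK !mulmxA.
have trP k : complex.Re (\tr (rX k)) = \sum_s P k s.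
  by have [V1 _ _ ->] := dV' k; rewrite mxtrace_mulC mulmxA V1 mul1mx tr_rdiag.
have vX k : ventropy (rX k) = - \sum_s xlog2x (P k s).
  by have [V1 _ _ ->] := dV' k; rewrite ventropy_decomp.
have vB : ventropy rB = - \sum_j xlog2x (r j) by rewrite eG ventropy_decomp.
have vW l : ventropy (W l *m rho *m W l) = - \sum_s xlog2x (q l s).
  by have [V1 _ _ ->] := dV l; rewrite ventropy_decomp.
have vr : ventropy rho = - \sum_i xlog2x (p i) by rewrite eU ventropy_decomp.
have P0 k s : 0 <= P k s by have [_ _ ? _] := dV' k.
have q0 l s : 0 <= q l s by have [_ _ ? _] := dV l.
have hP k s : 0 < P k s -> 0 < h k.
  move=> Pk; rewrite lt0r h0 andbT; apply/eqP => /hX0 e.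
  have := trP k; rewrite e mxtrace0 => /esym /(psumr_eq0P (fun s _ => P0 k s)) /(_ s isT) e'.
  by rewrite e' ltxx in Pk.
pose w (x : Oz * 'I_N * 'I_N) := p x.1.2 * nsq (a x.1.1 x.2 x.1.2).
pose w' (x : Ox * 'I_b * 'I_b) := P x.1.1 x.1.2 * nsq (c x.1.1 x.2 x.1.2).
have big3 (O : finType) n F :
    \sum_(x : O * 'I_n * 'I_n) F x = \sum_k \sum_i \sum_j F (k, i, j) :> R.
  by rewrite pair_big /= pair_big /=; apply: eq_bigr => -[[]].
have w0 x : 0 <= w x by rewrite mulr_ge0 ?nsq_ge0.
have w'0 x : 0 <= w' x by rewrite mulr_ge0 ?nsq_ge0.
(* Support condition: [q l s] is a sum of nonnegative weights, so one nonzero weight makes it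
   positive. The same holds for [r] below. *)
have wpos x : w x != 0 -> 0 < p x.1.2 /\ 0 < q x.1.1 x.2.
  move=> wx; split.
    by rewrite lt0r p0 andbT; apply: contra_neq wx; rewrite /w => ->; rewrite mul0r.
  rewrite lt0r q0 andbT; apply: contra_neq wx => /eqP.
  rewrite -aq => /eqP/psumr_eq0P; apply => // i _.
  by rewrite mulr_ge0 ?nsq_ge0.
have w'pos x : w' x != 0 -> 0 < P x.1.1 x.1.2 /\ 0 < r x.2.
  move=> wx; split.
    by rewrite lt0r P0 andbT; apply: contra_neq wx; rewrite /w' => ->; rewrite mul0r.
  rewrite lt0r r0 andbT; apply: contra_neq wx; rewrite -cr pair_big /=.
  move=> /psumr_eq0P H; apply: (H _ x.1 isT) => i _.
  by rewrite mulr_ge0 ?nsq_ge0.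
have := @resolvent_relent R _ _ w (fun x => p x.1.2) (fun x => q x.1.1 x.2)
   w' (fun x => P x.1.1 x.1.2) (fun x => h x.1.1 * r x.2) wpos.
have l20 : 0 < ln 2 :> R by rewrite ln_gt0 // ltr1n.
have -> : \sum_i w i * (ln (p i.1.2) - ln (q i.1.1 i.2)) =
   ln 2 * (\sum_l ventropy (W l *m rho *m W l) - ventropy rho).
  have -> : \sum_l ventropy (W l *m rho *m W l) - ventropy rho =
      (\sum_i p i * ln (p i) - \sum_l \sum_s q l s * ln (q l s)) / ln 2.
    rewrite vr opprK addrC mulrBl !mulr_suml -sumrN; congr (_ + _).
      by apply: eq_bigr => i _; rewrite xlog2xE.
    apply: eq_bigr => l _; rewrite vW mulr_suml; congr (- _).
    by apply: eq_bigr => s _; rewrite xlog2xE.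
  rewrite mulrCA divff ?gt_eqF // mulr1 big3 /w /=.
  under eq_bigr do under eq_bigr do under eq_bigr do rewrite mulrBr.
  under eq_bigr do under eq_bigr do rewrite sumrB.
  under eq_bigr do rewrite sumrB.
  rewrite sumrB; congr (_ - _).
    rewrite exchange_big /=; apply: eq_bigr => i _.
    under eq_bigr do rewrite -mulr_suml -mulr_sumr.
    by rewrite -mulr_suml -mulr_sumr a1 mulr1.
  apply: eq_bigr => l _; rewrite exchange_big /=; apply: eq_bigr => s _.
  by rewrite -mulr_suml aq.
have -> : \sum_j w' j * (ln (P j.1.1 j.1.2) - ln (h j.1.1 * r j.2)) =
   ln 2 * (ventropy rB - \sum_k ventropy (rX k) - \sum_k complex.Re (\tr (rX k)) * log2 (h k)).
  have -> : ventropy rB - \sum_k ventropy (rX k) -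
        \sum_k complex.Re (\tr (rX k)) * log2 (h k) =
      (\sum_k \sum_s P k s * ln (P k s) - \sum_k (\sum_s P k s) * ln (h k)
       - \sum_j r j * ln (r j)) / ln 2.
    have -> : \sum_k ventropy (rX k) = - (\sum_k \sum_s P k s * ln (P k s)) / ln 2.
      rewrite mulNr mulr_suml -sumrN; apply: eq_bigr => k _.
      by rewrite vX mulr_suml; congr (- _); apply: eq_bigr => s _; rewrite xlog2xE.
    have -> : ventropy rB = - (\sum_j r j * ln (r j)) / ln 2.
      by rewrite vB mulNr mulr_suml; congr (- _); apply: eq_bigr => j _; rewrite xlog2xE.
    have -> : \sum_k complex.Re (\tr (rX k)) * log2 (h k) =
        (\sum_k (\sum_s P k s) * ln (h k)) / ln 2.
      by rewrite mulr_suml; apply: eq_bigr => k _; rewrite trP mulrA.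
    by ring.
  rewrite mulrCA divff ?gt_eqF // mulr1.
  (* The logarithm of [h k * r j] splits only where both factors are positive, which a nonzero
     weight guarantees. *)
  transitivity (\sum_j w' j * (ln (P j.1.1 j.1.2) - ln (h j.1.1) - ln (r j.2))).
    apply: eq_bigr => x _; have [->|wx] := eqVneq (w' x) 0; first by rewrite !mul0r.
    have [Px rx] := w'pos x wx; rewrite lnM ?posrE ?(hP _ x.1.2) //.
    by rewrite opprD addrA.
  rewrite big3 /w' /=.
  under eq_bigr do under eq_bigr do under eq_bigr do rewrite !mulrBr.
  under eq_bigr do under eq_bigr do rewrite !sumrB.
  under eq_bigr do rewrite !sumrB.
  rewrite !sumrB; congr (_ - _ - _).
  - apply: eq_bigr => k _; apply: eq_bigr => s _.
    by rewrite -mulr_suml -mulr_sumr c1 mulr1.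
  - apply: eq_bigr => k _; rewrite mulr_suml; apply: eq_bigr => s _.
    by rewrite -mulr_suml -mulr_sumr c1 mulr1.
  - transitivity (\sum_k \sum_j \sum_s P k s * nsq (c k j s) * ln (r j)).
      by apply: eq_bigr => k _; exact: exchange_big.
    rewrite exchange_big /=; apply: eq_bigr => j _.
    under eq_bigr do rewrite -mulr_suml.
    by rewrite -mulr_suml cr.
rewrite ler_pM2l // => H; rewrite -subr_ge0; have := H _ _ _; rewrite -subr_ge0.
move=> H'; have := H' _ _ _; set A := (X in 0 <= X); set B := (X in _ -> 0 <= X).
have -> : A = B by rewrite /A /B; ring.
apply.
- move=> x wx; have [Px rx] := w'pos x wx; split=> //.
  by rewrite mulr_gt0 // (hP _ x.1.2).
- rewrite !big3 /w /w' /=.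
  transitivity (\sum_i p i).
    rewrite exchange_big /=; apply: eq_bigr => i _.
    under eq_bigr do rewrite -mulr_sumr.
    by rewrite -mulr_sumr a1 mulr1.
  (* The total weights are traces, and [trB] at the identity gives equal traces of [rB] and
     [rho]. *)
  transitivity (\sum_j r j).
    transitivity (complex.Re (\tr rho)).
      by rewrite eU mxtrace_mulC mulmxA U1 mul1mx tr_rdiag.
    by rewrite -[rho]mulmx1 -pi1 -trB mulmx1 eG mxtrace_mulC mulmxA G1 mul1mx tr_rdiag.
  rewrite -(eq_bigr _ (fun j _ => cr j)) exchange_big /=; apply: eq_bigr => k _.
  by rewrite exchange_big.
move=> u u01.
(* The optimal [Y] for the memory pair is lifted to a test operator for the measured pair, with
   [W l *m W l] in the role of [Z l]. *)
have [Y [eY eY']] := out_bound h u dG dV'.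
have trQ := tr_liftY trX Y; rewrite eY in trQ.
have := in_bound hW W1 dU dV u01 trQ.
rewrite -lecR => /(le_trans _); rewrite !big3; apply.
have hZ l : adjmx (W l *m W l) = W l *m W l by rewrite adjmxM hW.
have piZ l Y' : W l *m W l *m pi Y' = pi Y' *m (W l *m W l).
  by rewrite -mulmxA piW !mulmxA piW.
have B1 := tr_liftY_gram prho pX X1 piM piA piX trX Y.
have B2 := tr_liftY_gramr prho pX X1 hZ piM piA piX piZ trB hX Y.
have /andP[u0 u1] := u01.
have c0 : 0 <= u%:C :> C by rewrite lecR ltW.
have c1' : 0 <= (1 - u)%:C :> C by rewrite lecR subr_ge0 ltW.
(* The lift has linear value [Q], so it remains to bound its quadratic form by [Q], which [eY']
   identifies with the quadratic form of [Y]. *)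
rewrite mulrDl mul1r -addrA lerDl subr_ge0 -{1}eY'.
by apply: lerD; rewrite ler_wpM2l.
Qed.
End MeasuredEntropy.

(** * Operators indexed by finite types *)

Section Operators.
Set Implicit Arguments. Unset Strict Implicit. Unset Printing Implicit Defensive.
Local Open Scope complex_scope.
Variable R : realType.
Local Notation C := R[i].

Definition mxR (T U : finType) (f : T -> U -> C) : 'M[C]_(#|T|, #|U|) :=
  \matrix_(i, j) f (enum_val i) (enum_val j).

Lemma sum_enum_val (V : nmodType) (T : finType) (F : T -> V) :
  \sum_(i < #|T|) F (enum_val i) = \sum_x F x.
Proof. by rewrite [RHS](reindex (@enum_val T T)) //; apply/onW_bij/enum_val_bij. Qed.

Lemma mxR_mul (T U V : finType) (f : T -> U -> C) (g : U -> V -> C) :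
  mxR f *m mxR g = mxR (fun x z => \sum_y f x y * g y z).
Proof.
apply/matrixP => i j; rewrite !mxE -[RHS]sum_enum_val.
by apply: eq_bigr => k _; rewrite !mxE.
Qed.

Lemma mxR_adj (T U : finType) (f : T -> U -> C) :
  adjmx (mxR f) = mxR (fun y x => (f x y)^*%R).
Proof. by apply/matrixP => i j; rewrite adjmxE !mxE. Qed.

Lemma eq_mxR (T U : finType) (f g : T -> U -> C) : f =2 g -> mxR f = mxR g.
Proof. by move=> e; apply/matrixP => i j; rewrite !mxE e. Qed.

Lemma mxR1 (T : finType) : mxR (fun x y : T => (x == y)%:R) = 1%:M.
Proof. by apply/matrixP => i j; rewrite !mxE (inj_eq enum_val_inj). Qed.

Lemma mxtrace_mxOf (T : finType) (f : Op R T) : \tr (mxOf f) = \sum_x f x x.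
Proof. by rewrite -[RHS]sum_enum_val; apply: eq_bigr => i _; rewrite mxE. Qed.

Lemma mxOfK (T : finType) (f : Op R T) x y : opOf (mxOf f) x y = f x y.
Proof. by rewrite /opOf mxE !enum_rankK. Qed.

Lemma opOfK (T : finType) (M : 'M[C]_#|T|) : mxOf (opOf M) = M.
Proof. by apply/matrixP => i j; rewrite mxE /opOf !enum_valK. Qed.

Lemma eq_Sop (T : finType) (f g : Op R T) : f =2 g -> Sop f = Sop g.
Proof. by move=> e; congr ventropy; exact: eq_mxR. Qed.

Lemma Sop_mulC (T U : finType) (f : T -> U -> C) (g : U -> T -> C) :
  Sop (fun x y => \sum_u f x u * g u y) = Sop (fun u v => \sum_x g u x * f x v).
Proof. by rewrite /Sop -[mxOf _]mxR_mul ventropy_mulC mxR_mul. Qed.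

Lemma Sop_tr (T : finType) (f : Op R T) : Sop (fun x y => f y x) = Sop f.
Proof.
by rewrite /Sop -ventropy_tr; congr ventropy; apply/matrixP => i j; rewrite !mxE.
Qed.

(** The relabelled operator is a product with the permutation kernel of [h]; cycling the factors
    cancels it. *)
Lemma Sop_reindex (T U : finType) (f : Op R U) (h : T -> U) : bijective h ->
  Sop (fun x y => f (h x) (h y)) = Sop f.
Proof.
case=> g hg gh.
transitivity (Sop (fun x y => \sum_u f (h x) u * (u == h y)%:R)).
  apply: eq_Sop => x y; rewrite (bigD1 (h y)) //= eqxx mulr1 big1 ?addr0 // => u /negPf ->.
  by rewrite mulr0.
rewrite Sop_mulC; apply: eq_Sop => u v.
rewrite (bigD1 (g u)) //= gh eqxx mul1r big1 ?addr0 // => x.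
by case: (u =P h x) => [->|_ _]; rewrite ?hg ?eqxx ?mul0r.
Qed.

Lemma Sop_decomp (T I : finType) (f : Op R T) (e : I -> T -> C) (p : I -> R) :
  (forall i j, \sum_x e i x * (e j x)^*%R = (i == j)%:R) ->
  (forall x y, f x y = \sum_i (e i x)^*%R * ((p i)%:C * e i y)) ->
  Sop f = - \sum_i xlog2x (p i).
Proof.
move=> oe fE; rewrite -sum_enum_val.
rewrite -(@ventropy_decomp _ _ _ (mxR e)); last first.
  by rewrite mxR_adj mxR_mul -mxR1; apply: eq_mxR.
congr ventropy.
have -> : rdiag (fun i => p (enum_val i)) = mxR (fun i j : I => (i == j)%:R * (p i)%:C).
  apply/matrixP => i j; rewrite !mxE (inj_eq enum_val_inj).
  by case: (i =P j) => [->|_]; rewrite ?mul1r ?mul0r ?mulr1n ?mulr0n.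
rewrite mxR_adj -mulmxA !mxR_mul; apply: eq_mxR => x y; rewrite fE.
apply: eq_bigr => i _; congr (_ * _).
rewrite (bigD1 i) //= eqxx mul1r big1 ?addr0 // => j /negPf.
by rewrite eq_sym => ->; rewrite !mul0r.
Qed.

Lemma psd_Sop (T : finType) (f : Op R T) : psd f ->
  exists (e : T -> T -> C) (p : T -> R),
    [/\ forall i j, \sum_x e i x * (e j x)^*%R = (i == j)%:R, forall i, 0 <= p i,
        forall x y, f x y = \sum_i (e i x)^*%R * ((p i)%:C * e i y) &
        Sop f = - \sum_i xlog2x (p i)].
Proof.
move=> /psd_spectral [U [p [U1 _ p0 eU]]].
pose e i x := U (enum_rank i) (enum_rank x).
have UE : U = mxR e by apply/matrixP => i j; rewrite mxE /e !enum_valK.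
have oe i j : \sum_x e i x * (e j x)^*%R = (i == j)%:R.
  move: U1; rewrite UE mxR_adj mxR_mul => /matrixP/(_ (enum_rank i) (enum_rank j)).
  by rewrite !mxE !enum_rankK (inj_eq enum_rank_inj).
have fE x y : f x y = \sum_i (e i x)^*%R * ((p (enum_rank i))%:C * e i y).
  rewrite -[f x y]mxOfK eU /opOf -mulmxA mxE -[RHS]sum_enum_val; apply: eq_bigr => i _.
  by rewrite adjmxE /rdiag mul_diag_mx !mxE /e !enum_valK.
exists e, (fun i => p (enum_rank i)); split=> //.
exact: Sop_decomp.
Qed.

(** Eigenvectors of the blocks, extended by zero, form an orthonormal eigenfamily of the whole. *)
Lemma Sop_block (K T : finType) (g : K -> Op R T) : (forall k, psd (g k)) ->
  Sop (fun x y : K * T => if x.1 == y.1 then g x.1 x.2 y.2 else 0) = \sum_k Sop (g k).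
Proof.
move=> pg.
have /choice [ep hep] : forall k, exists ep : (T -> T -> C) * (T -> R),
    [/\ forall i j, \sum_x ep.1 i x * (ep.1 j x)^*%R = (i == j)%:R,
        forall x y, g k x y = \sum_i (ep.1 i x)^*%R * ((ep.2 i)%:C * ep.1 i y) &
        Sop (g k) = - \sum_i xlog2x (ep.2 i)].
  by move=> k; have [e [p [? _ ? ?]]] := psd_Sop (pg k); exists (e, p).
rewrite (@Sop_decomp _ (K * T)%type _
    (fun i x => if i.1 == x.1 then (ep i.1).1 i.2 x.2 else 0) (fun i => (ep i.1).2 i.2)).
- rewrite -(pair_bigA _ (fun k i => xlog2x ((ep k).2 i))) -sumrN /=.
  by apply: eq_bigr => k _; have [_ _ ->] := hep k.
- move=> [k i] [l j]; rewrite -(pair_bigA _ (fun k' x => (if k == k' then (ep k).1 i x else 0) *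
     (if l == k' then (ep l).1 j x else 0)^*%R)) /=.
  rewrite (bigD1 k) //= eqxx [X in _ + X]big1 ?addr0; last first.
    by move=> k' /negPf; rewrite eq_sym => ->; rewrite big1 // => x _; rewrite mul0r.
  rewrite xpair_eqE; have [<-|nk] := eqVneq l k; first by have [-> _ _] := hep l; rewrite ?eqxx.
  by rewrite ?[k == l]eq_sym ?(negPf nk) big1 // => x _; rewrite conjC0 mulr0.
move=> [k x] [l y] /=.
rewrite -(pair_bigA _ (fun k' i => (if k' == k then (ep k').1 i x else 0)^*%R *
   (((ep k').2 i)%:C * (if k' == l then (ep k').1 i y else 0)))) /=.
rewrite (bigD1 k) //= eqxx [X in _ + X]big1 ?addr0; last first.
  by move=> k' /negPf ->; rewrite big1 // => i _; rewrite conjC0 mul0r.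
have [_|nk] := eqVneq k l; first by have [_ -> _] := hep k.
by rewrite big1 // => i _; rewrite !mulr0.
Qed.
End Operators.

(** * The measured-state bound for a pure state on four systems *)

Section TripartiteBound.
Set Implicit Arguments. Unset Strict Implicit. Unset Printing Implicit Defensive.
Local Open Scope complex_scope.
Variable R : realType.
Local Notation C := R[i].

Definition kron (T U : finType) (M : 'M[C]_#|T|) (N : 'M[C]_#|U|) : 'M[C]_#|{: T * U}| :=
  mxOf (fun x y : T * U => opOf M x.1 y.1 * opOf N x.2 y.2).

Lemma sum_pair (V : nmodType) (T U : finType) (F : T * U -> V) :
  \sum_p F p = \sum_t \sum_u F (t, u).
Proof. by rewrite pair_bigA; apply: eq_bigr => -[]. Qed.

Lemma opOf_mul (T : finType) (M N : 'M[C]_#|T|) x y :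
  opOf (M *m N) x y = \sum_z opOf M x z * opOf N z y.
Proof.
by rewrite /opOf mxE -[RHS]sum_enum_val; apply: eq_bigr => i _; rewrite enum_valK.
Qed.

Lemma opOf1 (T : finType) x y : opOf (1%:M : 'M[C]_#|T|) x y = (x == y)%:R.
Proof. by rewrite /opOf mxE (inj_eq enum_rank_inj). Qed.

Lemma kronM (T U : finType) (M M' : 'M[C]_#|T|) (N N' : 'M[C]_#|U|) :
  kron M N *m kron M' N' = kron (M *m M') (N *m N').
Proof.
rewrite /kron [LHS]mxR_mul; apply: eq_mxR => x y.
rewrite !opOf_mul big_distrlr pair_big /=; apply: eq_bigr => -[t u] _ /=.
by rewrite mulrACA.
Qed.

Lemma kron1 (T U : finType) : kron (1%:M : 'M_#|T|) (1%:M : 'M_#|U|) = 1%:M.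
Proof.
rewrite -[RHS]mxR1; apply: eq_mxR => x y; rewrite !opOf1 -natrM mulnb.
by case: x y => [? ?] [? ?]; rewrite xpair_eqE.
Qed.

Lemma adj_kron (T U : finType) (M : 'M[C]_#|T|) (N : 'M[C]_#|U|) :
  adjmx (kron M N) = kron (adjmx M) (adjmx N).
Proof.
rewrite [LHS]mxR_adj; apply: eq_mxR => x y.
by rewrite rmorphM /opOf !adjmxE.
Qed.

Lemma kron_sum (T U : finType) (I : Type) r (M : I -> 'M[C]_#|T|) (N : 'M[C]_#|U|) :
  kron (\sum_(i <- r) M i) N = \sum_(i <- r) kron (M i) N.
Proof.
apply/matrixP => i j; rewrite mxE summxE {1}/opOf summxE mulr_suml.
by apply: eq_bigr => k _; rewrite mxE.
Qed.

Lemma kronB (T U : finType) (M M' : 'M[C]_#|T|) (N : 'M[C]_#|U|) :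
  kron (M - M') N = kron M N - kron M' N.
Proof. by apply/matrixP => i j; rewrite !mxE /opOf !mxE mulrBl. Qed.

Lemma kron_scalar (T U : finType) c :
  kron (c%:M : 'M[C]_#|T|) (1%:M : 'M[C]_#|U|) = c%:M.
Proof.
apply/matrixP => i j.
have /matrixP/(_ i j) := kron1 T U; rewrite !mxE => e.
have -> : opOf (c%:M : 'M[C]_#|T|) (enum_val i).1 (enum_val j).1 =
    c * opOf 1%:M (enum_val i).1 (enum_val j).1 by rewrite /opOf !mxE mulr_natr.
by rewrite -mulrA e mulr_natr.
Qed.

Lemma psd_kron1 (T U : finType) (M : 'M[C]_#|T|) : psdmx M -> psdmx (kron M (1%:M : 'M_#|U|)).
Proof.
move=> /psd_factor [K ->].
have -> : kron (adjmx K *m K) (1%:M : 'M_#|U|) = adjmx (kron K 1%:M) *m kron K 1%:M.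
  by rewrite adj_kron kronM adjmx1 mulmx1.
exact: psd_gram.
Qed.

(** The marginal on [T] of the pure, possibly unnormalised, vector [phi] on [T (x) K]. *)
Definition pureRed (T K : finType) (phi : T -> K -> C) : Op R T :=
  fun x y => \sum_k phi x k * (phi y k)^*%R.

Lemma psd_pureRed (T K : finType) (phi : T -> K -> C) : psd (pureRed phi).
Proof.
pose g k x := (phi x k)^*%R; rewrite /psd (_ : mxOf _ = adjmx (mxR g) *m mxR g).
  exact: psd_gram.
rewrite mxR_adj mxR_mul; apply: eq_mxR => x y.
by apply: eq_bigr => k _; rewrite conjCK.
Qed.

Lemma kron1_mulmx (T U : finType) (M : 'M[C]_#|T|) (f : Op R (T * U)%type) :
  kron M 1%:M *m mxOf f = mxOf (fun x y => \sum_a opOf M x.1 a * f (a, x.2) y).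
Proof.
rewrite [LHS]mxR_mul; apply: eq_mxR => x y.
rewrite sum_pair; apply: eq_bigr => t _.
rewrite (bigD1 x.2) //= opOf1 eqxx mulr1 big1 ?addr0 // => u.
by rewrite opOf1 eq_sym => /negPf ->; rewrite mulr0 mul0r.
Qed.

Lemma mulmx_kron1 (T U : finType) (M : 'M[C]_#|T|) (f : Op R (T * U)%type) :
  mxOf f *m kron M 1%:M = mxOf (fun x y => \sum_a f x (a, y.2) * opOf M a y.1).
Proof.
rewrite [LHS]mxR_mul; apply: eq_mxR => x y.
rewrite sum_pair; apply: eq_bigr => t _.
rewrite (bigD1 y.2) //= opOf1 eqxx mulr1 big1 ?addr0 // => u.
by rewrite opOf1 => /negPf ->; rewrite !mulr0.
Qed.

Lemma POVM_mx (T O : finType) (X : O -> Op R T) : isPOVM X ->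
  \sum_k mxOf (X k) = 1%:M.
Proof.
move=> [_ X1]; apply/matrixP => i j; rewrite summxE !mxE.
under eq_bigr do rewrite mxE.
by rewrite X1 /opid (inj_eq enum_val_inj).
Qed.

Lemma sqrtm_adj n (M : 'M[C]_n) : psdmx M -> adjmx (sqrtm M) = sqrtm M.
Proof. by move=> /psd_sqrt [[? _] _]. Qed.

Lemma sqrtm_sqr n (M : 'M[C]_n) : psdmx M -> sqrtm M *m sqrtm M = M.
Proof. by move=> /psd_sqrt []. Qed.

Section Bound.
Variables (A B Cc D Ox Oz : finType) (psi : A -> B -> Cc -> D -> C).
Variables (X : Ox -> Op R A) (Z : Oz -> Op R A).
Hypothesis POVMX : isPOVM X.
Hypothesis POVMZ : isPOVM Z.

(** Swapping the second and third arguments of [psi] turns this into the marginal on [A] and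
    [Cc]. *)
Definition redFst : Op R (A * B)%type :=
  pureRed (fun x (k : Cc * D) => psi x.1 x.2 k.1 k.2).
Definition redABD : Op R (A * (B * D))%type :=
  pureRed (fun x c => psi x.1 x.2.1 c x.2.2).

Let rX k : Op R B := fun b b' => \sum_a \sum_a' X k a a' * redFst (a', b) (a, b').

Lemma mxtrace_redABD (M : 'M[C]_#|A|) (Y : 'M[C]_#|B|) :
  \tr (mxOf redABD *m kron M (kron Y 1%:M)) =
  \sum_b \sum_b' (\sum_a \sum_a' opOf M a a' * redFst (a', b) (a, b')) * opOf Y b' b.
Proof.
rewrite mxR_mul mxtrace_mxOf.
pose F b b' a a' d :=
  opOf M a a' * (\sum_c psi a' b c d * (psi a b' c d)^*%R) * opOf Y b' b.
transitivity (\sum_a' \sum_b \sum_d \sum_a \sum_b' F b b' a a' d).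
  rewrite sum_pair; apply: eq_bigr => a' _; rewrite sum_pair; apply: eq_bigr => b _.
  apply: eq_bigr => d _; rewrite sum_pair; apply: eq_bigr => a _.
  rewrite sum_pair; apply: eq_bigr => b' _ /=; rewrite (bigD1 d) //= big1 ?addr0.
    by rewrite /F mxOfK opOf1 eqxx mulr1 mulrCA mulrA.
  by move=> d' /negPf nd; rewrite mxOfK opOf1 /= nd !mulr0.
rewrite exchange_big /=; apply: eq_bigr => b _.
transitivity (\sum_(p : A * D) \sum_(q : A * B) F b q.2 q.1 p.1 p.2).
  rewrite [RHS]sum_pair; apply: eq_bigr => a' _; apply: eq_bigr => d _.
  by rewrite [RHS]sum_pair.
rewrite exchange_big sum_pair exchange_big /=; apply: eq_bigr => b' _.
rewrite mulr_suml; apply: eq_bigr => a _; rewrite mulr_suml sum_pair.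
apply: eq_bigr => a' _; rewrite /redFst /pureRed sum_pair exchange_big /=.
by rewrite mulr_sumr mulr_suml.
Qed.

(** Writing [X k = K^dag K] exhibits [rX k] as a marginal of the vector [(K (x) 1) psi]. *)
Lemma psd_rX k : psd (rX k).
Proof.
have [K eK] := psd_factor (POVMX.1 k).
rewrite /psd (_ : mxOf (rX k) = mxOf (pureRed (fun b (i : A * (Cc * D)) =>
   \sum_a opOf K i.1 a * psi a b i.2.1 i.2.2))); first exact: psd_pureRed.
apply: eq_mxR => b b'.
have XE a a' : X k a a' = \sum_i (opOf K i a)^*%R * opOf K i a'.
  rewrite -[LHS]mxOfK eK opOf_mul; apply: eq_bigr => i _.
  by rewrite {1}/opOf adjmxE.
transitivity (\sum_(i : A * (Cc * D)) \sum_a' \sum_a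
    opOf K i.1 a' * psi a' b i.2.1 i.2.2 * (opOf K i.1 a * psi a b' i.2.1 i.2.2)^*%R).
  rewrite exchange_big /=; under [RHS]eq_bigr do rewrite exchange_big /=.
  rewrite [RHS]exchange_big /=; apply: eq_bigr => a _; apply: eq_bigr => a' _.
  rewrite XE /redFst /pureRed big_distrlr sum_pair /=; apply: eq_bigr => i _.
  by apply: eq_bigr => j _; rewrite rmorphM /=; ring.
apply: eq_bigr => i _; rewrite rmorph_sum big_distrlr /=.
by apply: eq_bigr.
Qed.

Lemma mx_hk k : mxOf (fun a a' => \sum_l opmul (opmul (Z l) (X k)) (Z l) a a') =
  \sum_l mxOf (Z l) *m mxOf (X k) *m mxOf (Z l).
Proof.
under [RHS]eq_bigr do rewrite [mxOf _ *m mxOf (X k)]mxR_mul [_ *m mxOf _]mxR_mul.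
by apply/matrixP => i j; rewrite summxE mxE; apply: eq_bigr => l _; rewrite mxE.
Qed.

(** A positive operator of norm 0 has trace 0, so with [X k = K^dag K] every [K Z_l] vanishes;
    summing over [l] gives [K = 0]. Outcomes where [log2 (hk X Z k)] is a junk value thus have
    probability 0. *)
Lemma hk_eq0 k : hk X Z k = 0 -> X k =2 fun _ _ => 0.
Proof.
rewrite /hk mx_hk; set N := \sum_l _ => N0.
have [K eK] := psd_factor (POVMX.1 k).
have eN : N = \sum_l adjmx (K *m mxOf (Z l)) *m (K *m mxOf (Z l)).
  by apply: eq_bigr => l _; rewrite adjmxM (POVMZ.1 l).1 eK !mulmxA.
have pN : psdmx N by rewrite eN; apply: psd_sum => l _; exact: psd_gram.
have p1 : psdmx (1%:M : 'M[C]_#|A|) by rewrite -[1%:M]mulmx1 -{1}adjmx1; exact: psd_gram.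
have /eqP trN : \tr N == 0.
  rewrite eq_le -[N]mulmx1 (psd_mxtrace_ge0 pN p1) andbT mulmx1.
  have := psd_mxtrace_ge0 (psd_opnorm_sub pN) p1.
  by rewrite N0 mulmx1 linearB /= raddf0 mxtrace0 sub0r oppr_ge0.
have KZ l : K *m mxOf (Z l) = 0.
  apply: mxtrace_gram_eq0; move: trN; rewrite eN raddf_sum /= => /psumr_eq0P; apply => // i _.
  exact: mxtrace_gram_ge0.
have K0 : K = 0.
  by rewrite -[K]mulmx1 -(POVM_mx POVMZ) mulmx_sumr big1.
by move=> a a'; rewrite -[LHS]mxOfK eK K0 mulmx0 /opOf mxE.
Qed.

(** [measured_entropy_bound] with [W l = sqrt Z_l (x) 1] and [pi Y = 1 (x) Y (x) 1]; the norm bound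
    on [A] survives tensoring with the identity. *)
Theorem measured_redABD :
  - \sum_k prob X (ptrR redFst) k * log2 (hk X Z k) <=
  Sop (cqXY X redFst) - Sop (ptrL redFst) + (Sop (postXAY Z redABD) - Sop redABD).
Proof.
have pX k : psdmx (mxOf (X k)) := POVMX.1 k.
have pZ l : psdmx (mxOf (Z l)) := POVMZ.1 l.
pose W l : 'M[C]_#|{: A * (B * D)}| := kron (sqrtm (mxOf (Z l))) 1%:M.
have hW l : adjmx (W l) = W l by rewrite adj_kron adjmx1 sqrtm_adj.
have WW l : W l *m W l = kron (mxOf (Z l)) 1%:M by rewrite kronM mulmx1 sqrtm_sqr.
have -> : Sop (cqXY X redFst) = \sum_k ventropy (mxOf (rX k)).
  by rewrite -(Sop_block psd_rX).
have eW l : W l *m mxOf redABD *m W l = mxOf (fun x y : A * (B * D) =>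
   \sum_a1 \sum_a2 sqrtOp (Z l) x.1 a1 * redABD (a1, x.2) (a2, y.2) * sqrtOp (Z l) a2 y.1).
  rewrite kron1_mulmx mulmx_kron1; apply: eq_mxR => x y.
  under eq_bigr do rewrite mulr_suml.
  by rewrite exchange_big.
have -> : Sop (postXAY Z redABD) = \sum_l ventropy (W l *m mxOf redABD *m W l).
  under eq_bigr do rewrite eW.
  rewrite -(Sop_block (g := fun l (x y : A * (B * D)) =>
    \sum_a1 \sum_a2 sqrtOp (Z l) x.1 a1 * redABD (a1, x.2) (a2, y.2) * sqrtOp (Z l) a2 y.1)) //.
  move=> l; rewrite /psd -eW -{1}hW; apply: psd_conj; exact: psd_pureRed.
have tX k Y : \tr (mxOf (rX k) *m Y) =
   \tr (mxOf redABD *m kron (mxOf (X k)) 1%:M *m kron 1%:M (kron Y 1%:M)).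
  rewrite -mulmxA kronM mulmx1 mul1mx mxtrace_redABD -{1}[Y]opOfK mxR_mul mxtrace_mxOf.
  apply: eq_bigr => b _; apply: eq_bigr => b' _; congr (_ * _).
  by apply: eq_bigr => a _; apply: eq_bigr => a' _; rewrite mxOfK.
have sX : \sum_k mxOf (rX k) = mxOf (ptrL redFst).
  apply/matrixP => i j; rewrite summxE mxE /ptrL.
  under eq_bigr do rewrite mxE.
  rewrite exchange_big /=; apply: eq_bigr => a _; rewrite exchange_big /=.
  under eq_bigr do rewrite -mulr_suml POVMX.2 /opid.
  rewrite (bigD1 a) //= eqxx mul1r big1 ?addr0 // => a' /negPf.
  by rewrite eq_sym => ->; rewrite mul0r.
have -> : \sum_k prob X (ptrR redFst) k * log2 (hk X Z k) =
   \sum_k complex.Re (\tr (mxOf (rX k))) * log2 (hk X Z k).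
  apply: eq_bigr => k _; congr (complex.Re _ * _); rewrite mxtrace_mxOf [RHS]exchange_big /=.
  apply: eq_bigr => a _; rewrite [RHS]exchange_big /=; apply: eq_bigr => a' _.
  by rewrite -mulr_sumr.
apply: (@measured_entropy_bound R Ox Oz _ _ (mxOf redABD)
   (fun k => kron (mxOf (X k)) 1%:M) W (fun Y => kron 1%:M (kron Y 1%:M))) => //.
- exact: psd_pureRed.
- by move=> k; exact: psd_kron1.
- by rewrite -kron_sum POVM_mx // kron1.
- by under eq_bigr do rewrite WW; rewrite -kron_sum POVM_mx // kron1.
- by rewrite !kron1.
- by move=> Y Y'; rewrite !kronM !mulmx1.
- by move=> Y; rewrite !adj_kron !adjmx1.
- by move=> k Y; rewrite !kronM !mulmx1 !mul1mx.
- by move=> l Y; rewrite !kronM !mulmx1 !mul1mx.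
- by rewrite -sX; apply: psd_sum => k _; exact: psd_rX.
- exact: psd_rX.
- move=> Y; rewrite -sX mulmx_suml raddf_sum /=.
  under eq_bigr do rewrite tX.
  by rewrite -raddf_sum /= -mulmx_suml -mulmx_sumr -kron_sum POVM_mx // kron1 mulmx1.
- by move=> k; exact: opnorm_ge0.
- move=> k /hk_eq0 X0; apply/matrixP => i j; rewrite !mxE /rX.
  by rewrite big1 // => a _; rewrite big1 // => a' _; rewrite X0 mul0r.
move=> k; rewrite -kron_scalar.
under eq_bigr do rewrite WW !kronM !mulmx1.
rewrite -kron_sum -kronB; apply: psd_kron1.
rewrite /hk mx_hk; apply: psd_opnorm_sub; apply: psd_sum => l _.
by rewrite -{1}(pZ l).1; exact: psd_conj.
Qed.
End Bound.
End TripartiteBound.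

(** * Uncertainty relations for a pair of POVMs *)

Section PairUncertainty.
Set Implicit Arguments. Unset Strict Implicit. Unset Printing Implicit Defensive.
Local Open Scope complex_scope.
Variable R : realType.
Local Notation C := R[i].

(** Complementary marginals of a pure vector have equal entropy; the transposition only
    conjugates. *)
Lemma Sop_dual (A Y K : finType) (phi : A -> Y -> K -> C) :
  Sop (pureRed (fun (x : A * Y) k => phi x.1 x.2 k)) =
  Sop (ptrL (pureRed (fun (x : A * K) y => phi x.1 y x.2))).
Proof.
rewrite Sop_mulC -Sop_tr; apply: eq_Sop => k k'; rewrite sum_pair; apply: eq_bigr => a _.
by apply: eq_bigr => y _; rewrite mulrC.
Qed.

Lemma sqrtOp_mul (A : finType) (f : Op R A) a b : psd f ->
  \sum_c sqrtOp f a c * sqrtOp f c b = f a b.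
Proof. by move=> pf; rewrite -opOf_mul sqrtm_sqr // mxOfK. Qed.

(** The kernel [f] is the amplitude of the measured vector with the outcome recorded on both sides.
    Its two marginals live on [O, A, Y] and on [O, K]; in the second, the square roots recombine to
    [Z l]. *)
Lemma Sop_dual_post (A Y K O : finType) (phi : A -> Y -> K -> C) (Z : O -> Op R A) :
  (forall k, psd (Z k)) ->
  Sop (postXAY Z (pureRed (fun (x : A * Y) k => phi x.1 x.2 k))) =
  Sop (cqXY Z (pureRed (fun (x : A * K) y => phi x.1 y x.2))).
Proof.
move=> pZ; pose Sq l := sqrtOp (Z l).
pose f (x : O * (A * Y)) (u : O * K) : C :=
  if x.1 == u.1 then \sum_a Sq x.1 x.2.1 a * phi a x.2.2 u.2 else 0.
(* The adjoint kernel of [f], with the square root already taken self-adjoint. *)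
pose g (u : O * K) (x : O * (A * Y)) : C :=
  if u.1 == x.1 then \sum_a (phi a x.2.2 u.2)^*%R * Sq x.1 a x.2.1 else 0.
transitivity (Sop (fun x y => \sum_u f x u * g u y)).
  apply: eq_Sop => -[l [a y]] [l' [a' y']]; rewrite sum_pair /postXAY /=.
  rewrite (bigD1 l) //= [X in _ + X]big1 ?addr0; last first.
    by move=> l2 /negPf nl; rewrite big1 // => k _; rewrite /f /= eq_sym nl mul0r.
  rewrite /f /g /= eqxx; case: eqP => [<-|_]; last by rewrite big1 // => k _; rewrite mulr0.
  under [RHS]eq_bigr do rewrite big_distrlr /=.
  rewrite [RHS]exchange_big /=; apply: eq_bigr => a1 _.
  rewrite [RHS]exchange_big /=; apply: eq_bigr => a2 _.
  rewrite /pureRed mulr_sumr mulr_suml; apply: eq_bigr => k _ /=.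
  by rewrite -/(Sq l); ring.
rewrite Sop_mulC -Sop_tr; apply: eq_Sop => -[l k] [l' k']; rewrite sum_pair /cqXY /=.
rewrite (bigD1 l) //= [X in _ + X]big1 ?addr0; last first.
  by move=> l2 /negPf nl; rewrite big1 // => p _; rewrite /f /= nl mulr0.
rewrite sum_pair /f /g /= eqxx eq_sym.
case: eqP => [_|_]; last by rewrite big1 // => a _; rewrite big1 // => y _; rewrite mul0r.
transitivity (\sum_a \sum_a'' \sum_y \sum_b
    (phi a y k')^*%R * Sq l a b * (Sq l b a'' * phi a'' y k)).
  transitivity (\sum_(x : A * Y) \sum_a \sum_a''
    (phi a x.2 k')^*%R * Sq l a x.1 * (Sq l x.1 a'' * phi a'' x.2 k)).
    by rewrite sum_pair; apply: eq_bigr => b _; apply: eq_bigr => y _; rewrite big_distrlr.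
  rewrite exchange_big /=; apply: eq_bigr => a _.
  rewrite exchange_big /=; apply: eq_bigr => a'' _.
  by rewrite sum_pair exchange_big.
apply: eq_bigr => a _; apply: eq_bigr => a'' _; rewrite /pureRed mulr_sumr.
apply: eq_bigr => y _ /=; rewrite -(sqrtOp_mul _ _ (pZ l)) mulr_suml.
by apply: eq_bigr => b _; rewrite -/(Sq l); ring.
Qed.

(** Purity turns the entropy gain of the measurement on [A, B, D] into the conditional entropy of
    [Z] given [K]. The second entry of the maximum follows by exchanging [X, B] with [Z, K]. *)
Lemma tripartite_uncertainty (A B K D Ox Oz : finType) (psi : A -> B -> K -> D -> C)
    (X : Ox -> Op R A) (Z : Oz -> Op R A) rA :
  isPOVM X -> isPOVM Z -> rA = ptrR (redFst psi) ->
  qXX X Z rA <= condS_XY X rA (redFst psi) +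
                condS_XY Z rA (redFst (fun a k b d => psi a b k d)).
Proof.
have half (B' K' Ox' Oz' : finType) (psi' : A -> B' -> K' -> D -> C)
    (X' : Ox' -> Op R A) (Z' : Oz' -> Op R A) : isPOVM X' -> isPOVM Z' ->
    - \sum_k prob X' (ptrR (redFst psi')) k * log2 (hk X' Z' k) <=
    (Sop (cqXY X' (redFst psi')) - Sop (ptrL (redFst psi'))) +
    (Sop (cqXY Z' (redFst (fun a k b d => psi' a b k d))) -
     Sop (ptrL (redFst (fun a k b d => psi' a b k d)))).
  move=> PX PZ; apply: le_trans (measured_redABD psi' PX PZ) _.
  pose phi a (y : B' * D) k := psi' a y.1 k y.2.
  by rewrite (Sop_dual phi) (Sop_dual_post phi) //; case: PZ.
move=> PX PZ erA; rewrite /qXX ge_max /condS_XY; apply/andP; split.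
  by rewrite erA half.
have -> : rA = ptrR (redFst (fun a k b d => psi a b k d)).
  rewrite erA; apply/funext => a; apply/funext => a'; rewrite /ptrR /redFst /pureRed.
  under eq_bigr do rewrite sum_pair.
  rewrite exchange_big /=; apply: eq_bigr => k _.
  by rewrite sum_pair.
by rewrite addrC; apply: (half _ _ _ _ (fun a k b d => psi a b k d)).
Qed.

Lemma sum_unit (V : nmodType) (F : unit -> V) : \sum_u F u = F tt.
Proof. by rewrite (bigD1 tt) //= big1 ?addr0 // => -[]. Qed.

Lemma psd_purify (T : finType) (f : Op R T) : psd f -> exists phi : T -> T -> C, f = pureRed phi.
Proof.
move=> /psd_factor [K eK]; exists (fun x k => (opOf K k x)^*%R).
apply/funext => x; apply/funext => y; rewrite -[LHS]mxOfK eK opOf_mul.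
by apply: eq_bigr => k _; rewrite conjCK {1}/opOf adjmxE.
Qed.

(** The second memory is a purification of [rho] and [D] is trivial; duality then rewrites the term
    of [Z] through [rho] itself. *)
Lemma memory_half (A Y Ox Oz : finType) (rho : Op R (A * Y)%type)
    (X : Ox -> Op R A) (Z : Oz -> Op R A) rA :
  psd rho -> isPOVM X -> isPOVM Z -> rA = ptrR rho ->
  qXX X Z rA <= condS_XY X rA rho + (Sop (postXAY Z rho) - Sop rho).
Proof.
move=> /psd_purify [phi ephi] PX PZ erA.
pose psi a y k (_ : unit) := phi (a, y) k.
have e1 : redFst psi = rho.
  rewrite ephi; apply/funext => -[a y]; apply/funext => -[a' y'].
  by rewrite /redFst /pureRed sum_pair; apply: eq_bigr => k _; rewrite sum_unit.
have := tripartite_uncertainty (psi := psi) PX PZ; rewrite e1 => /(_ _ erA).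
suff -> : condS_XY Z rA (redFst (fun a k b d => psi a b k d)) =
    Sop (postXAY Z rho) - Sop rho by [].
pose phi' a y k := phi (a, y) k.
have -> : rho = pureRed (fun (x : A * Y) k => phi' x.1 x.2 k).
  by rewrite ephi; apply/funext => -[? ?]; apply/funext => -[].
rewrite (Sop_dual phi') (Sop_dual_post phi'); last by case: PZ.
rewrite /condS_XY.
suff -> : redFst (fun a k b d => psi a b k d) =
    pureRed (fun (x : A * (A * Y)) y => phi' x.1 y x.2) by [].
apply/funext => x; apply/funext => y; rewrite /redFst /pureRed sum_pair.
by apply: eq_bigr => k _; rewrite sum_unit.
Qed.

Lemma qXXC (A Ox Oz : finType) (X : Ox -> Op R A) (Z : Oz -> Op R A) rA :
  qXX X Z rA = qXX Z X rA.
Proof. exact: maxC. Qed.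

(** By definition [S(rho_ZAY) - S(rho_AY) = S(A|YZ) + S(Z|Y) - S(A|Y)]. Using [memory_half] in both
    orders allows either term in the minimum. *)
Lemma memory_uncertainty (A Y Ox Oz : finType) (rho : Op R (A * Y)%type)
    (X : Ox -> Op R A) (Z : Oz -> Op R A) rA :
  psd rho -> isPOVM X -> isPOVM Z -> rA = ptrR rho ->
  qXX X Z rA + condS_AY rho - Num.min (condS_A_YX X rho) (condS_A_YX Z rho) <=
  condS_XY X rA rho + condS_XY Z rA rho.
Proof.
move=> pr PX PZ erA.
have h1 := memory_half pr PX PZ erA.
have h2 := memory_half pr PZ PX erA; rewrite qXXC in h2.
rewrite /condS_AY /condS_A_YX /condS_XY /= in h1 h2 *.
by rewrite /Num.min; case: ifP => _; lra.
Qed.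

Lemma Sop_unit1 (f : Op R unit) : f tt tt = 1 -> Sop f = 0.
Proof.
move=> f1; rewrite (@Sop_decomp _ _ unit f (fun _ _ => 1) (fun=> 1)).
- by rewrite sum_unit /xlog2x oner_eq0 /log2 ln1 mul0r mulr0 oppr0.
- by move=> [] []; rewrite sum_unit conjC1 mulr1.
by move=> [] []; rewrite sum_unit f1 conjC1 !mulr1.
Qed.

(** * The case of a one-dimensional memory *)

Section NoMemory.
Variables (A O : finType) (rA : Op R A) (X : O -> Op R A).
Hypothesis prA : psd rA.
Hypothesis PX : isPOVM X.
Let rU : Op R (A * unit)%type := fun p q => rA p.1 q.1.

Let fst_bij (T : finType) : bijective (@fst T unit).
Proof. by exists (fun x => (x, tt)) => // -[? []]. Qed.

Lemma Sop_noMemory : Sop rU = Sop rA.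
Proof. exact: (Sop_reindex _ (fst_bij A)). Qed.

Let pU (k k' : O) : C := if k == k' then (prob X rA k)%:C else 0.

Let probE k : \sum_a \sum_a' X k a a' * rA a' a = (prob X rA k)%:C.
Proof.
rewrite RRe_real //; apply: ger0_real.
have := psd_mxtrace_ge0 (PX.1 k) prA.
by rewrite mxR_mul mxtrace_mxOf.
Qed.

Let Sop_pU : Sop pU = shannon X rA.
Proof.
rewrite (@Sop_decomp _ _ O pU (fun k k' => (k == k')%:R) (prob X rA)) //.
  move=> k l; rewrite (bigD1 k) //= eqxx mul1r big1 ?addr0 => [|k' /negPf].
    by rewrite conjC_nat eq_sym.
  by rewrite eq_sym => ->; rewrite mul0r.
move=> k l; rewrite (bigD1 k) //= eqxx conjC1 mul1r big1 ?addr0 => [|k' /negPf ->].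
  by rewrite /pU; case: eqP; rewrite ?mulr1 ?mulr0.
by rewrite conjC0 mul0r.
Qed.

Lemma Sop_cq_noMemory : Sop (cqXY X rU) = shannon X rA.
Proof.
rewrite -Sop_pU -(Sop_reindex _ (fst_bij O)); apply: eq_Sop => -[k u] [l v].
by rewrite /cqXY /pU /= -probE.
Qed.

Lemma Sop_rhoX : Sop (rhoX X rA) = shannon X rA.
Proof.
rewrite -Sop_pU; apply: eq_Sop => k l; rewrite /rhoX /ptrR /postXA /pU /=.
case: eqP => _; last by rewrite big1.
rewrite -probE exchange_big [RHS]exchange_big /=; apply: eq_bigr => a1 _.
rewrite exchange_big /=; apply: eq_bigr => a2 _.
rewrite -(sqrtOp_mul _ _ (PX.1 k)) mulr_suml; apply: eq_bigr => a _; ring.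
Qed.

Lemma Sop_post_noMemory : Sop (postXAY X rU) = Sop (postXA X rA).
Proof.
pose h (x : O * (A * unit)) := (x.1, x.2.1).
have bh : bijective h.
  by exists (fun x => (x.1, (x.2, tt))) => [[? [? []]]|[? ?]].
by rewrite -(Sop_reindex _ bh).
Qed.

End NoMemory.

(** [memory_uncertainty] with memory [unit], whose state is the number 1 and has entropy 0. *)
Lemma uncertainty_noMemory (A Ox Oz : finType) (X : Ox -> Op R A) (Z : Oz -> Op R A) rA :
  psd rA -> \sum_a rA a a = 1 -> isPOVM X -> isPOVM Z ->
  qXX X Z rA + Sop rA - Num.min (condS_A_X X rA) (condS_A_X Z rA) <=
  shannon X rA + shannon Z rA.
Proof.
move=> prA tr1 PX PZ; pose rU : Op R (A * unit)%type := fun p q => rA p.1 q.1.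
have prU : psd rU.
  have [phi e] := psd_purify prA.
  have -> : rU = pureRed (fun (x : A * unit) k => phi x.1 k) by rewrite /rU e.
  exact: psd_pureRed.
have erU : rA = ptrR rU.
  by apply/funext => a; apply/funext => a'; rewrite /ptrR sum_unit.
have S1 : Sop (ptrL rU) = 0 by apply: Sop_unit1.
have := memory_uncertainty prU PX PZ erU.
rewrite /condS_AY /condS_XY /condS_A_YX S1 !subr0 !Sop_cq_noMemory // Sop_noMemory.
by rewrite !Sop_post_noMemory /condS_A_X !Sop_rhoX.
Qed.
End PairUncertainty.

(** * Marginals of the multipartite state *)

Section Marginals.
Set Implicit Arguments. Unset Strict Implicit. Unset Printing Implicit Defensive.
Local Open Scope complex_scope.
Variable R : realType.
Local Notation C := R[i].
Variables (n : nat) (A : finType) (B : 'I_n -> finType).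
Local Notation BB := {dffun forall t : 'I_n, B t}.

Definition upd (c : BB) (t : 'I_n) (x : B t) : BB := [ffun s => dfwith c x s].

Lemma upd_in (c : BB) t (x : B t) : upd c x t = x.
Proof. by rewrite ffunE dfwith_in. Qed.

Lemma upd_out (c : BB) t (x : B t) s : t != s -> upd c x s = c s.
Proof. by move=> ts; rewrite ffunE dfwith_out. Qed.

Lemma upd_upd (c : BB) t (x y : B t) : upd (upd c x) y = upd c y.
Proof.
apply/ffunP => s; have [<-|ts] := eqVneq t s; first by rewrite !upd_in.
by rewrite !upd_out.
Qed.

Lemma upd_id (c : BB) t : upd c (c t) = c.
Proof.
apply/ffunP => s; have [<-|ts] := eqVneq t s; first by rewrite upd_in.
by rewrite upd_out.
Qed.

Lemma updC (c : BB) t t' (x : B t) (y : B t') : t != t' ->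
  upd (upd c x) y = upd (upd c y) x.
Proof.
move=> tt'; apply/ffunP => s; have [<-|ts] := eqVneq t s.
  by rewrite upd_in upd_out ?upd_in // eq_sym.
rewrite [RHS]upd_out //; have [<-|ts'] := eqVneq t' s; first by rewrite !upd_in.
by rewrite !upd_out.
Qed.

(** A configuration is its value at [t] together with a configuration pinned at [t]; pinning stands
    in for an index type of the other components. *)
Lemma sum_upd (V : nmodType) (g0 : BB) t (G : BB -> V) :
  \sum_b G b = \sum_(x : B t) \sum_(c : BB | c t == g0 t) G (upd c x).
Proof.
rewrite (partition_big (fun b : BB => b t) xpredT) //=; apply: eq_bigr => x _.
rewrite (reindex_onto (fun c : BB => upd c x) (fun b : BB => upd b (g0 t))); last first.
  by move=> b /eqP <-; rewrite upd_upd upd_id.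
apply: eq_bigl => c; rewrite upd_in eqxx upd_upd /=.
by apply/eqP/eqP => [<-|e]; rewrite ?upd_in // -{1}e upd_id.
Qed.

(* [g0] pins the unused [t]-component of the summation index. *)
Lemma redABE (rho : Op R (Jsys A B)) (g0 : BB) t p p' :
  redAB rho t p p' =
  \sum_(c : BB | c t == g0 t) rho (p.1, upd c p.2) (p'.1, upd c p'.2).
Proof.
rewrite /redAB (sum_upd g0 t) (bigD1 p.2) //= [X in _ + X]big1 ?addr0; last first.
  move=> x /negPf nx; rewrite big1 // => c _; rewrite big1 // => b' _.
  by rewrite upd_in nx.
apply: eq_bigr => c _; rewrite (bigD1 (upd c p'.2)) //= !upd_in !eqxx /=.
rewrite ifT; last first.
  by apply/forallP => s; apply/implyP => st; rewrite !upd_out // eq_sym.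
rewrite big1 ?addr0 // => b' nb'; case: ifP => // /andP[/eqP e /forallP h].
case/eqP: nb'; apply/ffunP => s; have [<-|ts] := eqVneq t s; first by rewrite upd_in.
have /implyP/(_ _)/eqP <- := h s; last by rewrite eq_sym.
by rewrite !upd_out.
Qed.

Variable rho : Op R (Jsys A B).
Hypothesis drho : density rho.

(** Trace 1 forces a nonempty index set, which provides the values used for pinning. *)
Lemma density_point : exists g : BB, True.
Proof.
case: drho => _; have [g _|none] := pickP (fun _ : BB => true); first by exists g.
rewrite big1 => [/esym/eqP|[a g] _]; first by rewrite oner_eq0.
by have := none g.
Qed.

Lemma psd_redAB t : psd (redAB rho t).
Proof.
have [g0 _] := density_point; have [phi e] := psd_purify drho.1.
suff -> : redAB rho t = pureRed (fun (x : A * B t) (i : BB * Jsys A B) =>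
   if i.1 t == g0 t then phi (x.1, upd i.1 x.2) i.2 else 0) by exact: psd_pureRed.
apply/funext => p; apply/funext => p'; rewrite (redABE _ g0) big_mkcond /pureRed sum_pair.
apply: eq_bigr => c _ /=; case: ifP => _; last by rewrite big1 // => k _; rewrite mul0r.
by rewrite e.
Qed.

Lemma ptrR_redAB t : redA rho = ptrR (redAB rho t).
Proof.
have [g0 _] := density_point; apply/funext => a; apply/funext => a'.
rewrite /redA /ptrR (sum_upd g0 t); apply: eq_bigr => x _.
by rewrite (redABE _ g0).
Qed.

Lemma psd_redA : psd (redA rho).
Proof.
have [phi e] := psd_purify drho.1.
suff -> : redA rho = pureRed (fun a (i : BB * Jsys A B) => phi (a, i.1) i.2).
  exact: psd_pureRed.
apply/funext => a; apply/funext => a'; rewrite /redA /ptrR /pureRed sum_pair.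
by apply: eq_bigr => b _; rewrite e.
Qed.

Lemma tr_redA : \sum_a redA rho a a = 1.
Proof. by case: drho => _; rewrite sum_pair. Qed.

(** A purification of [rho] is regrouped as a vector on [A], [B t], [B t'] and the rest, to which
    [tripartite_uncertainty] applies. *)
Lemma distinct_uncertainty t t' (Ox Oz : finType) (X : Ox -> Op R A) (Z : Oz -> Op R A) :
  t != t' -> isPOVM X -> isPOVM Z ->
  qXX X Z (redA rho) <= condS_XY X (redA rho) (redAB rho t) +
                        condS_XY Z (redA rho) (redAB rho t').
Proof.
move=> tt' PX PZ; have [g0 _] := density_point; have [phi e] := psd_purify drho.1.
(* Vanishing off the pinned configurations makes each state of the remaining components count
   exactly once. *)
pose psi (a : A) (x : B t) (y : B t') (i : BB * Jsys A B) :=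
  if (i.1 t == g0 t) && (i.1 t' == g0 t') then phi (a, upd (upd i.1 y) x) i.2 else 0.
have psiE a a' x x' y y' :
    \sum_i psi a x y i * (psi a' x' y' i)^*%R =
    \sum_(c : BB | (c t == g0 t) && (c t' == g0 t'))
      rho (a, upd (upd c y) x) (a', upd (upd c y') x').
  rewrite sum_pair [RHS]big_mkcond; apply: eq_bigr => c _; rewrite /psi /=.
  case: ifP => _; last by rewrite big1 // => k _; rewrite mul0r.
  by rewrite e.
have e1 : redAB rho t = redFst psi.
  apply/funext => p; apply/funext => p'; rewrite (redABE _ g0) /redFst /pureRed sum_pair.
  rewrite big_mkcond (sum_upd g0 t'); apply: eq_bigr => y _ /=.
  rewrite psiE [RHS]big_mkcond /= big_mkcond; apply: eq_bigr => c _.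
  by rewrite upd_out 1?[t' == t]eq_sym //; case: (c t == g0 t); case: (c t' == g0 t').
have e2 : redAB rho t' = redFst (fun a y x i => psi a x y i).
  apply/funext => p; apply/funext => p'; rewrite (redABE _ g0) /redFst /pureRed sum_pair.
  rewrite big_mkcond (sum_upd g0 t); apply: eq_bigr => x _ /=.
  rewrite psiE [RHS]big_mkcond /= big_mkcond; apply: eq_bigr => c _.
  by rewrite upd_out // !(updC _ _ _ tt'); case: (c t == g0 t); case: (c t' == g0 t').
rewrite e1 e2; apply: tripartite_uncertainty => //.
by rewrite -e1; exact: ptrR_redAB.
Qed.
End Marginals.

(** * Sums over pairs *)

Section Pairs.
Set Implicit Arguments. Unset Strict Implicit. Unset Printing Implicit Defensive.

(** Each element of [T] lies in [#|T| - 1] pairs: the larger and the smaller partners together make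
    up [T] without it. *)
Lemma sum_pairs_set (R : realType) m (T : {set 'I_m}) (a : 'I_m -> R) :
  \sum_(i in T) \sum_(j in T | (i < j)%N) (a i + a j) =
  (#|T|%:R - 1) * \sum_(i in T) a i.
Proof.
under eq_bigr do rewrite big_split /=.
rewrite big_split /= [X in _ + X](exchange_big_dep (mem T)) /=; last by move=> i j _ /andP[].
rewrite -big_split mulr_sumr; apply: eq_bigr => i iT.
transitivity (\sum_(j in T :\ i) a i); last first.
  by rewrite sumr_const (cardsD1 i T) iT natrD addrC addKr mulr_natl.
rewrite [RHS](bigID (fun j : 'I_m => (i < j)%N)) /=; congr (_ + _); apply: eq_bigl => j.
  by rewrite !inE -(inj_eq val_inj) /=; case: (ltngtP i j); rewrite ?andbF ?andbT.
by rewrite !inE -(inj_eq val_inj) /= iT; case: (ltngtP i j); rewrite ?andbF ?andbT.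
Qed.

Lemma sum_pairs (R : realType) m (a : 'I_m -> R) :
  \sum_(i < m) \sum_(j < m | (i < j)%N) (a i + a j) = (m%:R - 1) * \sum_i a i.
Proof.
have := sum_pairs_set [set: 'I_m] a; rewrite cardsT card_ord.
rewrite [\sum_(i in _) a i](eq_bigl xpredT); last by move=> i; rewrite inE.
move <-; rewrite [RHS](eq_bigl xpredT); last by move=> i; rewrite inE.
by apply: eq_bigr => i _; apply: eq_bigl => j; rewrite inE.
Qed.

(** The constant family [1/2] in [sum_pairs_set] counts every pair once. *)
Lemma card_pairs (R : realType) m (T : {set 'I_m}) :
  \sum_(i in T) \sum_(j in T | (i < j)%N) 1 = (#|T|%:R * (#|T|%:R - 1)) / 2 :> R.
Proof.
have := sum_pairs_set T (fun=> 2^-1 : R).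
rewrite sumr_const -[2^-1 *+ _]mulr_natr => h.
transitivity ((#|T|%:R - 1) * (2^-1 * #|T|%:R) : R); last by field.
rewrite -h; apply: eq_bigr => i _; by apply: eq_bigr => j _; field.
Qed.

Lemma sum_partition (R : realType) m n (S : 'I_n -> {set 'I_m}) (tau : 'I_m -> 'I_n)
    (F : 'I_n -> 'I_m -> R) : (forall i t, (i \in S t) = (tau i == t)) ->
  \sum_(t < n) \sum_(i in S t) F t i = \sum_i F (tau i) i.
Proof.
move=> St; rewrite (exchange_big_dep xpredT) //=; apply: eq_bigr => i _.
by rewrite (eq_bigl (pred1 (tau i))) ?big_pred1_eq // => t; rewrite St eq_sym.
Qed.

(** With [tau] the class map, sums inside classes become sums over all pairs, ready for termwise
    comparison. *)
Lemma sum_pairs_partition (R : realType) m n (S : 'I_n -> {set 'I_m}) (tau : 'I_m -> 'I_n)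
    (F : 'I_n -> 'I_m -> 'I_m -> R) : (forall i t, (i \in S t) = (tau i == t)) ->
  \sum_(t < n) \sum_(i in S t) \sum_(j in S t | (i < j)%N) F t i j =
  \sum_(i < m) \sum_(j < m | (i < j)%N) (if tau i == tau j then F (tau i) i j else 0).
Proof.
move=> St; rewrite (sum_partition _ St); apply: eq_bigr => i _.
rewrite big_mkcond [RHS]big_mkcond; apply: eq_bigr => j _.
by rewrite St eq_sym; case: (tau i == tau j); case: (i < j)%N.
Qed.

End Pairs.

(** * Summation over all pairs of POVMs *)

Theorem theorem4 (R : realType) (m n : nat) (A : finType) (B : 'I_n -> finType)
  (rho : Op R (Jsys A B)) (O : 'I_m -> finType) (X : forall i : 'I_m, O i -> Op R A)
  (S : 'I_n -> {set 'I_m}) :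
  (2 <= m)%N -> (1 <= n <= m)%N ->
  density rho ->
  (forall i, isPOVM (X i)) ->
  (forall t, S t != set0) ->
  (forall t t', t != t' -> [disjoint S t & S t']) ->
  \bigcup_(t < n) S t = [set: 'I_m] ->
  let mt t : R := (#|S t|)%:R in
  let rA := redA rho in
  let ft (t : 'I_n) (i j : 'I_m) : R :=
    Num.min (condS_A_YX (X i) (redAB rho t)) (condS_A_YX (X j) (redAB rho t)) in
  let ftil (i j : 'I_m) : R := Num.min (condS_A_X (X i) rA) (condS_A_X (X j) rA) in
  let kappa : R :=
      (m%:R * (m%:R - 1) - \sum_(t < n) mt t * (mt t - 1)) / (2 * (m%:R - 1)) * Sop rA
    + \sum_(t < n) (mt t * (mt t - 1)) / (2 * (m%:R - 1)) * mutual_AY (redAB rho t)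
    - \sum_(t < n) \sum_(i in S t) mutual_XY (X i) rA (redAB rho t)
    + (m%:R - 1)^-1 * (\sum_(t < n) \sum_(i in S t) \sum_(j in S t | (i < j)%N) ft t i j
                       - \sum_(i < m) \sum_(j < m | (i < j)%N) ftil i j) in
  \sum_(t < n) \sum_(i in S t) condS_XY (X i) rA (redAB rho t)
  >= (m%:R - 1)^-1 * \sum_(t < n) (mt t * (mt t - 1)) / 2 * condS_AY (redAB rho t)
   + (m%:R - 1)^-1 * \sum_(i < m) \sum_(j < m | (i < j)%N) qXX (X i) (X j) rA
   - (m%:R - 1)^-1 * \sum_(t < n) \sum_(i in S t) \sum_(j in S t | (i < j)%N) ft t i j
   + Num.max 0 kappa.
Proof.
move=> m2 _ drho PX Sne Sdisj Scov; lazy zeta.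
set rA := redA rho.
pose mt t : R := (#|S t|)%:R.
pose ft (t : 'I_n) (i j : 'I_m) : R :=
  Num.min (condS_A_YX (X i) (redAB rho t)) (condS_A_YX (X j) (redAB rho t)).
pose ftil (i j : 'I_m) : R := Num.min (condS_A_X (X i) rA) (condS_A_X (X j) rA).
have /choice [tau tauP] : forall i : 'I_m, exists t, i \in S t.
  move=> i; have : i \in \bigcup_(t < n) S t by rewrite Scov inE.
  by case/bigcupP => t _ it; exists t.
have St i t : (i \in S t) = (tau i == t).
  apply/idP/eqP => [it|<-]; last exact: tauP.
  apply/eqP/negPn/negP => /Sdisj; rewrite disjoint_subset => /subsetP/(_ i (tauP i)).
  by rewrite inE it.
have M0 : 0 < m%:R - 1 :> R by rewrite subr_gt0 ltr1n.
pose s i := condS_XY (X i) rA (redAB rho (tau i)).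
pose H i := shannon (X i) rA.
pose Q := \sum_(i < m) \sum_(j < m | (i < j)%N) qXX (X i) (X j) rA.
pose F := \sum_(t < n) \sum_(i in S t) \sum_(j in S t | (i < j)%N) ft t i j.
pose Ft := \sum_(i < m) \sum_(j < m | (i < j)%N) ftil i j.
pose K := \sum_(t < n) (mt t * (mt t - 1)) / 2 * condS_AY (redAB rho t).
have hs : \sum_(t < n) \sum_(i in S t) condS_XY (X i) rA (redAB rho t) = \sum_i s i.
  exact: (sum_partition (fun t i => condS_XY (X i) rA (redAB rho t)) St).
have hI : \sum_(t < n) \sum_(i in S t) mutual_XY (X i) rA (redAB rho t) =
    \sum_i H i - \sum_i s i.
  rewrite (sum_partition (fun t i => mutual_XY (X i) rA (redAB rho t)) St) -sumrB.
  by apply: eq_bigr => i _; rewrite /mutual_XY /s /condS_XY /H; ring.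
have hK : K = \sum_(t < n) \sum_(i in S t) \sum_(j in S t | (i < j)%N) condS_AY (redAB rho t).
  apply: eq_bigr => t _; rewrite -card_pairs mulr_suml; apply: eq_bigr => i _.
  by rewrite mulr_suml; apply: eq_bigr => j _; rewrite mul1r.
(* Pairs inside a class use [memory_uncertainty], pairs across classes [distinct_uncertainty]; each
   [s i] occurs [m - 1] times. *)
have bound1 : Q + K - F <= (m%:R - 1) * \sum_i s i.
  rewrite -sum_pairs hK /F (sum_pairs_partition (fun t i j => condS_AY (redAB rho t)) St).
  rewrite (sum_pairs_partition ft St) /Q -big_split -sumrB; apply: ler_sum => i _ /=.
  rewrite -big_split -sumrB; apply: ler_sum => j _ /=; rewrite /s.
  have [<-|ne] := eqVneq (tau i) (tau j); last first.
    by rewrite addr0 subr0; exact: distinct_uncertainty.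
  apply: memory_uncertainty => //; first exact: psd_redAB.
  exact: ptrR_redAB.
(* The relation without memory, summed over all pairs; it settles the case [kappa > 0]. *)
have bound2 : Q + m%:R * (m%:R - 1) / 2 * Sop rA - Ft <= (m%:R - 1) * \sum_i H i.
  rewrite -sum_pairs /Q /Ft.
  have -> : m%:R * (m%:R - 1) / 2 * Sop rA = \sum_(i < m) \sum_(j < m | (i < j)%N) Sop rA.
    have := card_pairs R [set: 'I_m]; rewrite cardsT card_ord => <-.
    rewrite mulr_suml (eq_bigl xpredT); last by move=> i; rewrite inE.
    apply: eq_bigr => i _; rewrite mulr_suml (eq_bigl (fun j : 'I_m => (i < j)%N)).
      by apply: eq_bigr => j _; rewrite mul1r.
    by move=> j; rewrite inE.
  rewrite -big_split -sumrB; apply: ler_sum => i _ /=.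
  rewrite -big_split -sumrB; apply: ler_sum => j _ /=.
  by apply: uncertainty_noMemory => //; [exact: psd_redA|exact: tr_redA].
(* This rests on [I(A:B_t) = S(A) - S(A|B_t)]. *)
have hmut : \sum_(t < n) (mt t * (mt t - 1)) / (2 * (m%:R - 1)) * mutual_AY (redAB rho t) =
    ((\sum_(t < n) mt t * (mt t - 1)) / 2 * Sop rA - K) / (m%:R - 1).
  rewrite /K !mulr_suml -sumrB mulr_suml; apply: eq_bigr => t _.
  rewrite /mutual_AY /condS_AY -ptrR_redAB // -/rA; field; exact: lt0r_neq0.
have D0 := lt0r_neq0 M0.
rewrite hs; set kappa := (X in Num.max 0 X).
(* Adding this to [K + Q - F] cancels [K] and [F]; the resulting claim is exactly [bound2], while
   for [kappa <= 0] it is [bound1]. *)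
have ekappa : (m%:R - 1) * kappa = m%:R * (m%:R - 1) / 2 * Sop rA - K -
    (m%:R - 1) * (\sum_i H i - \sum_i s i) + (F - Ft).
  by rewrite /kappa hI hmut -/F -/Ft; field; exact: D0.
rewrite -(ler_pM2l M0).
rewrite [X in X <= _](_ : _ = K + Q - F + (m%:R - 1) * Num.max 0 kappa); last first.
  rewrite -/K -/Q -/F; move: (Num.max 0 kappa) => M; field; exact: D0.
have [k0|k0] := leP kappa 0; first by rewrite mulr0; lra.
by rewrite ekappa; lra.
Qed.
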